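(* Second-order homogeneous Hamiltonian operators in dimension $n$ can be put in bijection with $3$-forms in the $(n+1)$-dimensional space $\mathbb{C}^{n+1}$. A projective reciprocal transformation induces an $SL(n+1)$-transformation on the corresponding $3$-form which commutes with the action on the corresponding second-order homogeneous Hamiltonian operator.
   Context: Summation over repeated indices is understood; Latin indices run over $1,\dots,n$, where $n$ is the number of dependent variables $u^i=u^i(t,x)$ (the dimension), and Greek indices run over $1,\dots,n+1$. A second-order homogeneous Hamiltonian operator is considered in its canonical form (in flat coordinates) $P^{ij}=\partial_x g^{ij}\partial_x$, where $(g^{ij}(u))$ is the inverse of the matrix $g_{ij}=T_{ijk}u^k+g^0_{ij}$, with $T_{ijk}$ constant and skew-symmetric in $i,j,k$ and $g^0_{ij}$ constant and skew-symmetric in $i,j$. Operators are assumed to be non-degenerate, $\det(g^{ij})\neq0$. A projective reciprocal transformation is defined by a matrix $(a^\lambda_\mu)\in SL(n+1)$ and consists of a projective transformation of the dependent variables coupled with a non-local transformation of $x$: $$\tilde u^i=\frac{a^i_ju^j+a^i_{n+1}}{A},\qquad d\tilde x=A\,dx,\qquad d\tilde t=dt,\qquad A=a^{n+1}_ju^j+a^{n+1}_{n+1}.$$ It acts on operators through the associated brackets $\int \frac{\partial f}{\partial u^i}P^{ij}\frac{\partial h}{\partial u^j}\,dx$, where densities are transformed by $f=A\tilde f$, $h=A\tilde h$ and $\partial_x=A\,\partial_{\tilde x}$; the result is again an operator of the canonical form.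
   Formalization: Non-degenerate operators are matched with the 3-forms ω for which some ω(U,·,·) has rank n (for odd n no such operator exists, yet the zero 3-form does); all 3-forms are matched with all pairs (T, g^0), degenerate ones included. *)

(* Defs.v *)
(* MathComp / MathComp-Analysis. *)
From mathcomp Require Import all_boot all_order all_algebra complex.
From mathcomp Require Import all_classical all_reals topology normedtype derive.
Set Implicit Arguments.
Unset Strict Implicit.
Unset Printing Implicit Defensive.
Import Order.TTheory GRing.Theory Num.Theory numFieldNormedType.Exports.
Local Open Scope ring_scope.
Local Open Scope classical_set_scope.

(* R[i] with its numClosedFieldType structure exposed, so that the topology and
   the differential calculus available on every numFieldType apply to it. *)
Definition CC (R : realType) : numClosedFieldType := R[i].

Section Holomorphic.
Context {K : numFieldType} {V W : normedModType K}.

Fixpoint holomorphic_upto (k : nat) (O : set V) (f : V -> W) : Prop :=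
  (forall x, O x -> differentiable f x) /\
  if k is k'.+1 then forall v, holomorphic_upto k' O ('D_v f) else True.

(* For K = C and O open in a finite-dimensional V this is plain
   holomorphy; the existence of the higher derivatives, automatic over C, is
   part of the definition because the library does not provide it. *)
Definition holomorphic (O : set V) (f : V -> W) : Prop :=
  forall k, holomorphic_upto k O f.

End Holomorphic.

Section Operators.
Context {K : numFieldType} {n : nat}.
Local Notation V := 'cV[K]_n.

Definition tensors : Type :=
  (('I_n -> 'I_n -> 'I_n -> K) * ('I_n -> 'I_n -> K))%type.

Definition skew_tensors : set tensors := [set t |
  [/\ forall i j k, t.1 j i k = - t.1 i j k,
      forall i j k, t.1 i k j = - t.1 i j k &
      forall i j, t.2 j i = - t.2 i j]].

(* g_ij(u) = T_ijk u^k + g0_ij, for t = (T, g0) *)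
Definition lower_metric (t : tensors) (u : V) : 'M[K]_n :=
  \matrix_(i, j) (\sum_k t.1 i j k * u k 0 + t.2 i j).

(* (g^ij(u)); invmx fixes singular matrices, so that this matrix is
   invertible exactly at the points u where (g_ij(u)) is. *)
Definition upper_metric (t : tensors) (u : V) : 'M[K]_n :=
  invmx (lower_metric t u).

(* The operator d_x g^ij d_x is represented by its coefficient g = (g^ij), a
   function of u regular where it is invertible. As det (g_ij) is a
   polynomial in u, non-degeneracy means that it is not identically zero. *)
Definition hamiltonian_operators : set (V -> 'M[K]_n) := [set g |
  exists t, [/\ skew_tensors t, g = upper_metric t &
                exists u, g u \in unitmx]].

(* The derivation w^-1 d/dx, that is, d/dy where dy = w dx. *)
Definition total_D (w : K -> K) (F : K -> V) (x : K) : V :=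
  (w x)^-1 *: derive1 F x.

(* P psi along the field u = u(x), for P = d_y g^ij d_y with dy = w dx and
   psi a covector field along u. *)
Definition apply_operator (w : K -> K) (g : V -> 'M[K]_n) (u psi : K -> V)
    : K -> V :=
  total_D w (fun x => g (u x) *m total_D w psi x).

Definition gradient (f : V -> K) (u : V) : V :=
  \col_i 'D_(delta_mx i 0) f u.

(* The integrand of the bracket of the functionals with densities f and h,
   with respect to dy = w dx. *)
Definition bracket_density (w : K -> K) (g : V -> 'M[K]_n) (f h : V -> K)
    (u : K -> V) (x : K) : K :=
  \sum_i gradient f (u x) i 0 *
    apply_operator w g u (fun y => gradient h (u y)) x i 0.

(* The k-th column is the k-th derivative of u at x. *)
Definition jet (m : nat) (u : K -> V) (x : K) : 'M[K]_(n, m.+1) :=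
  \matrix_(i, k) derive1n k u x i 0.

(* The integral of L dx vanishes as a formal functional of the fields u with
   values in O: L is the total derivative of a function of finitely many
   derivatives of u. *)
Definition null_functional (O : set V) (L : (K -> V) -> K -> K) : Prop :=
  exists m, exists q : 'M[K]_(n, m.+1) -> K,
    (forall J, O (col 0 J) -> differentiable q J) /\
    forall (X : set K) (u : K -> V), open X -> holomorphic X u ->
      (forall x, X x -> O (u x)) ->
      forall x, X x -> L u x = derive1 (fun y => q (jet m u y)) x.

(* The rows and columns 1, .., n of a are indexed by lshift 1 i and the last
   one by rshift n 0. *)
Definition reciprocal_factor (a : 'M[K]_(n + 1)) (u : V) : K :=
  \sum_j a (rshift n 0) (lshift 1 j) * u j 0 + a (rshift n 0) (rshift n 0).

Definition projective_map (a : 'M[K]_(n + 1)) (u : V) : V :=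
  \col_i ((\sum_j a (lshift 1 i) (lshift 1 j) * u j 0
           + a (lshift 1 i) (rshift n 0)) / reciprocal_factor a u).

(* The operator with coefficient g' is the transform of the one with
   coefficient g: for all densities f', h', holomorphic on an open set of the
   new variables, and f = A f', h = A h', the brackets of f, h and of f', h'
   agree as functionals; d_x' = A^-1 d_x and dx' = A dx in the latter. *)
Definition reciprocal_transform (a : 'M[K]_(n + 1)) (g g' : V -> 'M[K]_n)
    : Prop :=
  let A := reciprocal_factor a in
  let phi := projective_map a in
  forall (O : set V) (f' h' : V -> K),
    open O -> holomorphic O f' -> holomorphic O h' ->
    let f := fun u => A u * f' (phi u) in
    let h := fun u => A u * h' (phi u) in
    null_functional
      [set u | [/\ A u != 0, g u \in unitmx, g' (phi u) \in unitmx
                 & O (phi u)]]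
      (fun u x => bracket_density (fun=> 1) g f h u x -
        bracket_density (A \o u) g' f' h' (phi \o u) x * A (u x)).

End Operators.

Section ThreeForms.
Context {K : numFieldType} {n : nat}.
Local Notation H := 'cV[K]_(n + 1).

Definition three_forms : set (H -> H -> H -> K) := [set om |
  [/\ forall Y Z, scalar (fun X => om X Y Z),
      forall X Z, scalar (fun Y => om X Y Z),
      forall X Y, scalar (fun Z => om X Y Z),
      forall X Z, om X X Z = 0 &
      forall X Y, om X Y Y = 0]].

(* As U lies in the kernel of the 2-form om(U, -, -), n is the largest
   possible rank of the latter. *)
Definition nondegenerate_three_forms : set (H -> H -> H -> K) :=
  three_forms `&` [set om | exists U : H,
    \rank (\matrix_(l, m) om U (delta_mx l 0) (delta_mx m 0)
             : 'M[K]_(n + 1)) = n].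

(* T_ijk = om_ijk and g0_ij = om_ij(n+1) *)
Definition tensors_of_form (om : H -> H -> H -> K) : @tensors K n :=
  let e i : H := delta_mx (lshift 1 i) 0 in
  let e_last : H := delta_mx (rshift n 0) 0 in
  (fun i j k => om (e i) (e j) (e k), fun i j => om (e i) (e j) e_last).

Definition operator_of_form (om : H -> H -> H -> K) : 'cV[K]_n -> 'M[K]_n :=
  upper_metric (tensors_of_form om).

Definition form_action (a : 'M[K]_(n + 1)) (om : H -> H -> H -> K)
    : H -> H -> H -> K :=
  fun X Y Z => om (invmx a *m X) (invmx a *m Y) (invmx a *m Z).

End ThreeForms.

(* Main.v *)
From HB Require Import structures.
Require Import Defs.
From mathcomp Require Import all_boot all_order all_algebra complex.
From mathcomp Require Import all_classical all_reals topology normedtype derive.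
From mathcomp Require Import landau ring lra.
Import Order.TTheory GRing.Theory Num.Theory numFieldNormedType.Exports.
Local Open Scope ring_scope.
Local Open Scope classical_set_scope.

Set Implicit Arguments.
Unset Strict Implicit.
Unset Printing Implicit Defensive.

(* A 3-form om on C^(n+1) and U = (u, 1) give the 2-form om(U, -, -), with U in
   its kernel and with (g_ij(u)) as its upper left block; this is invertible
   exactly when the 2-form has rank n, and generic U have nonzero last
   coordinate.

   Write P = d_x g d_x and, after the transformation by a, let phi be the
   projective map, A its denominator and A^-1 B its differential.  With
   om' = form_action a om, invariance of the 2-form reads
   B^T g'_low(phi u) B = A^-1 g_low(u), and f = A (f' o phi) gives
   d_x grad f = B^T d_x grad f'.  Hence w = g d_x grad h and
   w' = g' A^-1 d_x grad h' are related by w' = B w, and the difference of the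
   two brackets is the total derivative of f'(phi u) (c w), where c u + d = A.

   Conversely, if two operators g' and g'' are both transforms of g, then
   d_x grad f' (g' - g'') A^-1 d_x grad h' is a total derivative for all f', h'.
   Take f', h' to be squares of coordinates and let u run along a short line
   segment through a generic point and back, u = u0 + p(x) v with
   p = r (x (1 - x))^(m + 2).  All the jets up to order m agree at x = 0 and
   x = 1, while the integrand is a positive square times a function whose
   ratio to its nonzero value at the point has positive real part. *)

(** * Functions that are polynomial along every line, as a tool for genericity *)

Section LinePolynomials.
Context {K : numFieldType}.

(** A nonzero polynomial has fewer roots than its size, and in characteristic 0 the first [size p]
    numerals are pairwise distinct. *)
Lemma exists_nonroot (p : {poly K}) : p != 0 -> exists x, p.[x] != 0.
Proof.
move=> p0; set rs : seq K := [seq i%:R | i <- iota 0 (size p)].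
have [/hasP[x _ px]|] := boolP (has (fun x => p.[x] != 0) rs).
  by exists x.
rewrite -all_predC => /allP allroot.
suff : (size rs < size p)%N by rewrite size_map size_iota ltnn.
apply: max_poly_roots => //; first by apply/allP => x /allroot /=; rewrite negbK.
by rewrite map_inj_uniq ?iota_uniq //; exact: mulrIn (oner_neq0 K).
Qed.

(* The only property of a polynomial function that genericity arguments need. *)
Definition line_polynomial {V : lmodType K} (P : V -> K) :=
  forall u v, exists p : {poly K}, forall t, P (u + t *: v) = p.[t].

Lemma line_polynomialM {V : lmodType K} (P Q : V -> K) :
  line_polynomial P -> line_polynomial Q ->
  line_polynomial (fun u => P u * Q u).
Proof.
move=> hP hQ u v; have [p pE] := hP u v; have [q qE] := hQ u v.
by exists (p * q) => t; rewrite hornerM pE qE.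
Qed.

(** On the line joining the two points both functions restrict to nonzero polynomials, and the
    product of these has a nonroot. *)
Lemma line_polynomial_neq0 {V : lmodType K} (P Q : V -> K) :
  line_polynomial P -> line_polynomial Q ->
  (exists u, P u != 0) -> (exists u, Q u != 0) -> exists u, P u * Q u != 0.
Proof.
move=> hP hQ [u Pu] [v Qv].
have [p pE] := hP u (v - u); have [q qE] := hQ u (v - u).
have p0 : p != 0.
  apply: contraNneq Pu => p0.
  by rewrite -[u]addr0 -(scale0r (v - u)) pE p0 horner0.
have q0 : q != 0.
  apply: contraNneq Qv => q0.
  by rewrite -[v](subrKC u) -(scale1r (v - u)) qE q0 horner0.
have [t] := exists_nonroot (mulf_neq0 p0 q0).
by rewrite hornerM -pE -qE => ?; exists (u + t *: (v - u)).
Qed.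

(** A matrix affine in the parameter lifts to a matrix over [{poly K}]; evaluation is a ring
    morphism and so commutes with the determinant. *)
Lemma line_polynomial_det {V : lmodType K} n (M N : V -> 'M[K]_n) :
  (forall u v t, M (u + t *: v) = M u + t *: N v) ->
  line_polynomial (fun u => \det (M u)).
Proof.
move=> MN u v.
exists (\det (map_mx polyC (M u) + 'X *: map_mx polyC (N v))) => t.
rewrite -horner_evalE -det_map_mx MN; congr (\det _).
by apply/matrixP => i j; rewrite !mxE /= horner_evalE !hornerE.
Qed.

End LinePolynomials.

(** * Three-forms, their tensors, and the 2-forms obtained by contraction *)

Section Forms.
Context {K : numFieldType} {n : nat}.
Local Notation V := 'cV[K]_n.
Local Notation H := 'cV[K]_(n + 1).
Implicit Types (om : H -> H -> H -> K) (a : 'M[K]_(n + 1)) (u : V).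

Lemma scalar_sum {m : nat} (f : 'cV[K]_m -> K) : scalar f ->
  forall X, f X = \sum_l X l 0 * f (delta_mx l 0).
Proof.
move=> fl X; have f0 : f 0 = 0.
  have := fl 1 0 0; rewrite scaler0 addr0 mul1r => /eqP.
  by rewrite -subr_eq subrr eq_sym => /eqP.
rewrite {1}[X]matrix_sum_delta.
elim/big_rec2 : _ => // l _ y _ <-.
by rewrite big_ord1 fl.
Qed.

Lemma form_swap12 om : three_forms om -> forall X Y Z, om Y X Z = - om X Y Z.
Proof.
case=> l1 l2 l3 a1 a2 X Y Z; have := a1 (1 *: X + Y) Z.
rewrite l1 !l2 !a1 mulr0 !mul1r add0r addr0 => /eqP.
by rewrite addr_eq0 => /eqP ->; rewrite opprK.
Qed.

Lemma form_swap23 om : three_forms om -> forall X Y Z, om X Z Y = - om X Y Z.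
Proof.
case=> l1 l2 l3 a1 a2 X Y Z; have := a2 X (1 *: Y + Z).
rewrite l2 !l3 !a2 mulr0 !mul1r add0r addr0 => /eqP.
by rewrite addr_eq0 => /eqP ->; rewrite opprK.
Qed.

(** The last block has a single index, so [e i] and [e j] coincide here. *)
Lemma form_eq0 om : three_forms om -> forall X i j,
  let e i : H := delta_mx (rshift n i) 0 in
  [/\ om X (e i) (e j) = 0, om (e i) X (e j) = 0 & om (e i) (e j) X = 0].
Proof.
move=> h X i j /=; have [_ _ _ a1 a2] := h; rewrite !ord1.
by split; rewrite ?a1 ?a2 // form_swap12 // a2 oppr0.
Qed.

(** By trilinearity the values on basis vectors decide. They are given by [T] when no index is the
    last one, by [g0] up to sign when exactly one is, and vanish otherwise. *)
Lemma form_eq om om' : three_forms om -> three_forms om' ->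
  tensors_of_form om = tensors_of_form om' -> om = om'.
Proof.
move=> h h' [eT eg]; apply/funext => X; apply/funext => Y; apply/funext => Z.
have eTE i j k := congr1 (fun f => f i j k) eT.
have egE i j := congr1 (fun f => f i j) eg.
rewrite /= in eTE egE.
case: (h) => l1 l2 l3 _ _; case: (h') => l1' l2' l3' _ _.
rewrite (scalar_sum (l1 _ _)) (scalar_sum (l1' _ _)); apply: eq_bigr => i _.
congr (_ * _).
rewrite (scalar_sum (l2 _ _)) (scalar_sum (l2' _ _)); apply: eq_bigr => j _.
congr (_ * _).
rewrite (scalar_sum (l3 _ _)) (scalar_sum (l3' _ _)); apply: eq_bigr => k _.
congr (_ * _).
have E0 := form_eq0 h; have E0' := form_eq0 h'.
case: (split_ordP i) (split_ordP j) (split_ordP k) =>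
  [i' ->|i' ->] [j' ->|j' ->] [k' ->|k' ->].
- exact: eTE.
- by rewrite [k']ord1.
- by rewrite [j']ord1 (form_swap23 h) (form_swap23 h') egE.
- by have [-> _ _] := E0 (delta_mx (lshift 1 i') 0) j' k';
    have [-> _ _] := E0' (delta_mx (lshift 1 i') 0) j' k'.
- rewrite [i']ord1 (form_swap12 h) (form_swap23 h).
  by rewrite (form_swap12 h') (form_swap23 h') egE.
- by have [_ -> _] := E0 (delta_mx (lshift 1 j') 0) i' k';
    have [_ -> _] := E0' (delta_mx (lshift 1 j') 0) i' k'.
- by have [_ _ ->] := E0 (delta_mx (lshift 1 k') 0) i' j';
    have [_ _ ->] := E0' (delta_mx (lshift 1 k') 0) i' j'.
- by have [-> _ _] := E0 (delta_mx (rshift n i') 0) j' k';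
    have [-> _ _] := E0' (delta_mx (rshift n i') 0) j' k'.
Qed.

(** In tensor products of dual basis vectors, this is [T_ijk e^i e^j e^k] plus the three cyclic
    permutations of [g0_ij e^i e^j e^(n+1)]. The sums run over all indices, which is why no
    factorials appear. *)
Definition form_of_tensors (t : @tensors K n) (X Y Z : H) : K :=
  \sum_i \sum_j \sum_k t.1 i j k *
    (X (lshift 1 i) 0 * Y (lshift 1 j) 0 * Z (lshift 1 k) 0) +
  \sum_i \sum_j t.2 i j *
    (X (lshift 1 i) 0 * Y (lshift 1 j) 0 * Z (rshift n 0) 0 +
     Y (lshift 1 i) 0 * Z (lshift 1 j) 0 * X (rshift n 0) 0 +
     Z (lshift 1 i) 0 * X (lshift 1 j) 0 * Y (rshift n 0) 0).

Lemma eq_opp0 (x : K) : x = - x -> x = 0.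
Proof.
by move/eqP; rewrite -addr_eq0 -mulr2n mulrn_eq0 => /eqP.
Qed.

Ltac expand_linear :=
  rewrite /form_of_tensors mulrDr !mulr_sumr addrACA; congr (_ + _);
  rewrite -big_split /=; apply: eq_bigr => i _;
  rewrite !mulr_sumr -big_split /=; apply: eq_bigr => j _;
  [rewrite !mulr_sumr -big_split /=; apply: eq_bigr => k _|];
  by rewrite !mxE /=; ring.

(** On two equal arguments, exchanging summation indices and skewness show the value equal to its
    own opposite, hence zero in characteristic 0. *)
Lemma form_of_tensorsP t : skew_tensors t -> three_forms (form_of_tensors t).
Proof.
case=> s12 s23 s2; split.
- move=> Y Z r X X'; expand_linear.
- move=> X Z r Y Y'; expand_linear.
- move=> X Y r Z Z'; expand_linear.
- move=> X Z; apply: eq_opp0; rewrite {1}/form_of_tensors /form_of_tensors opprD.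
  rewrite [X in X + _ = _]exchange_big /= [X in _ + X = _]exchange_big /= -!sumrN.
  congr (_ + _); apply: eq_bigr => i _; rewrite -!sumrN; apply: eq_bigr => j _.
    by rewrite -!sumrN; apply: eq_bigr => k _; rewrite s12; ring.
  by rewrite s2; ring.
- move=> X Y; apply: eq_opp0; rewrite {1}/form_of_tensors /form_of_tensors opprD.
  rewrite [X in _ + X = _]exchange_big /= -!sumrN.
  congr (_ + _); apply: eq_bigr => i _; rewrite -!sumrN.
    rewrite exchange_big /=; apply: eq_bigr => j _.
    by rewrite -!sumrN; apply: eq_bigr => k _; rewrite s23; ring.
  by apply: eq_bigr => j _; rewrite s2; ring.
Qed.

(** Each remaining term contains a vanishing coordinate of a basis vector. *)
Ltac kill_offdiagonal :=
  repeat (let x := fresh in let h := fresh in move=> x h; rewrite ?big1 //);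
  rewrite !mxE;
  repeat match goal with H : is_true (_ != _) |- _ =>
    move/negPf: H => H end;
  rewrite ?eq_lshift ?eq_rlshift ?eq_lrshift ?eqxx;
  repeat match goal with H : (_ == _) = false |- _ => rewrite ?H; clear H end;
  rewrite /=; ring.

Lemma form_of_tensorsK t : tensors_of_form (form_of_tensors t) = t.
Proof.
have dr (i : 'I_n) (j : 'I_1) : (rshift n j == lshift 1 i) = false.
  by rewrite eq_rlshift.
have dr' (i : 'I_n) (j : 'I_1) : (lshift 1 i == rshift n j) = false.
  by rewrite eq_lrshift.
case: t => T g; rewrite /tensors_of_form; congr (_, _).
  apply/funext => i; apply/funext => j; apply/funext => k.
  rewrite /form_of_tensors /=.
  rewrite (bigD1 i) //= (bigD1 j) //= (bigD1 k) //= !mxE !eqxx !mulr1.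
  rewrite !big1 ?addr0 //; kill_offdiagonal.
apply/funext => i; apply/funext => j.
rewrite /form_of_tensors /=.
rewrite (bigD1 i) //= [X in _ + X](bigD1 i) //= [X in _ + (X + _)](bigD1 j) //=.
rewrite !mxE !eqxx !dr !dr' !mulr1.
rewrite !big1 ?addr0 ?add0r //; try by kill_offdiagonal.
by rewrite /=; ring.
Qed.

Lemma tensors_of_form_skew om : three_forms om -> skew_tensors (tensors_of_form om).
Proof.
move=> h; split=> [i j k|i j k|i j].
- exact: form_swap12.
- exact: form_swap23.
- exact: form_swap12.
Qed.

Lemma forms_tensors_bij :
  set_bij (@three_forms K n) skew_tensors tensors_of_form.
Proof.
split.
- exact: tensors_of_form_skew.
- by move=> om om' /set_mem h /set_mem h'; exact: form_eq.
- move=> t ht; exists (form_of_tensors t); last exact: form_of_tensorsK.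
  exact: form_of_tensorsP.
Qed.

(** Matrix of the interior product of [om] with [U]. *)
Definition form_contract om (U : H) : 'M[K]_(n + 1) :=
  \matrix_(l, m) om U (delta_mx l 0) (delta_mx m 0).

Definition homog u : H := col_mx u 1%:M.

Lemma form_contractE om U X Y : three_forms om ->
  om U X Y = (X^T *m form_contract om U *m Y) 0 0.
Proof.
case=> _ l2 l3 _ _; rewrite (scalar_sum (l2 _ _)) -mulmxA mxE.
apply: eq_bigr => l _; rewrite !mxE (scalar_sum (l3 _ _)); congr (_ * _).
by apply: eq_bigr => m _; rewrite !mxE mulrC.
Qed.

Lemma form_contract_linear om c U V : three_forms om ->
  form_contract om (c *: U + V) = c *: form_contract om U + form_contract om V.
Proof. by case=> l1 _ _ _ _; apply/matrixP => i j; rewrite !mxE l1. Qed.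

Lemma form_contractZ om c U : three_forms om ->
  form_contract om (c *: U) = c *: form_contract om U.
Proof.
move=> h; apply/matrixP => i j; rewrite !mxE; case: h => l1 _ _ _ _.
by rewrite (scalar_sum (l1 _ _)) (scalar_sum (l1 _ _) U) mulr_sumr;
  apply: eq_bigr => l _; rewrite !mxE mulrA.
Qed.

Lemma form_contract_self om U : three_forms om -> form_contract om U *m U = 0.
Proof.
move=> h; apply/matrixP => i j; rewrite ord1 mxE [RHS]mxE.
have [_ _ l3 _ _] := h.
transitivity (om U (delta_mx i 0) U).
  by rewrite (scalar_sum (l3 _ _)); apply: eq_bigr => l _; rewrite !mxE mulrC.
by rewrite form_swap23 //; have [_ _ _ -> _] := h; rewrite oppr0.
Qed.

Lemma form_contract_tr om U : three_forms om ->
  (form_contract om U)^T = - form_contract om U.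
Proof. by move=> h; apply/matrixP => i j; rewrite !mxE form_swap23. Qed.

Lemma form_contract_selfl om U : three_forms om -> U^T *m form_contract om U = 0.
Proof.
move=> h; rewrite -[form_contract _ _]trmxK -trmx_mul form_contract_tr // mulNmx.
by rewrite form_contract_self // oppr0 trmx0.
Qed.

(** Moving the contracted argument from the last place to the first is an even permutation, so no
    sign appears; the last coordinate 1 of [homog u] contributes [g0]. *)
Lemma lower_metric_contract om u : three_forms om ->
  lower_metric (tensors_of_form om) u = ulsubmx (form_contract om (homog u)).
Proof.
move=> h; apply/matrixP => i j; rewrite !mxE /=.
have [l1 _ _ _ _] := h; rewrite [RHS](scalar_sum (l1 _ _)) big_split_ord big_ord1 /=.
rewrite /homog col_mxEd mxE eqxx mul1r; congr (_ + _); last first.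
  by rewrite ord1 (form_swap23 h) (form_swap12 h) opprK.
apply: eq_bigr => k _; rewrite col_mxEu mulrC; congr (_ * _).
by rewrite (form_swap23 h) (form_swap12 h) opprK.
Qed.

Lemma rank_contract_homog om u : three_forms om ->
  \rank (form_contract om (homog u)) = \rank (lower_metric (tensors_of_form om) u).
Proof.
move=> h; set C := form_contract _ _; rewrite lower_metric_contract // -/C.
(* This base change replaces the last basis vector by [homog u], which lies in the kernel on both
   sides; congruence by it leaves only the upper left block. *)
pose Q : 'M_(n + 1) := block_mx 1%:M u 0 1%:M.
have Qu : Q \in unitmx by rewrite unitmxE det_ublock !det1 mulr1 unitr1.
have CQ : Q^T *m C *m Q = block_mx (ulsubmx C) 0 0 0.
  have C0 : C *m homog u = 0 by exact: form_contract_self.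
  have C0l : (homog u)^T *m C = 0 by exact: form_contract_selfl.
  have QE : Q = row_mx (col_mx 1%:M 0) (homog u) by rewrite /Q block_mxEh.
  rewrite QE tr_row_mx mul_col_mx C0l.
  rewrite mul_col_row !mul0mx -[in X in block_mx _ X]mulmxA C0 mulmx0; congr block_mx.
  rewrite -[C in LHS]submxK tr_col_mx trmx1 trmx0 mul_row_block mul_row_col.
  by rewrite !(mulmx1, mul1mx, mulmx0, mul0mx, addr0).
have QT : Q^T \in unitmx by rewrite unitmx_tr.
rewrite -(mxrankMfree C (_ : row_free Q)) ?row_free_unit //.
rewrite -(eqmxMfull (C *m Q) (_ : row_full Q^T)) ?row_full_unit //.
by rewrite mulmxA CQ rank_diag_block_mx mxrank0 addn0.
Qed.

End Forms.

(** * Regular metrics, and the bijection between forms and operators *)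

Section Operators.
Context {K : numFieldType} {n : nat}.
Local Notation V := 'cV[K]_n.
Local Notation H := 'cV[K]_(n + 1).
Implicit Types (om : H -> H -> H -> K) (a : 'M[K]_(n + 1)) (u : V).

Lemma lower_metric_line (t : @tensors K n) u v c :
  lower_metric t (u + c *: v) =
  lower_metric t u + c *: (lower_metric t v - lower_metric t 0).
Proof.
apply/matrixP => i j; rewrite !mxE.
have -> : \sum_k t.1 i j k * (u + c *: v) k 0 =
    \sum_k t.1 i j k * u k 0 + c * \sum_k t.1 i j k * v k 0.
  rewrite mulr_sumr -big_split /=.
  by apply: eq_bigr => k _; rewrite !mxE mulrDr mulrCA.
rewrite [X in _ = _ + _ * (_ - (X + _))]big1 => [|k _]; last by rewrite mxE mulr0.
ring.
Qed.

(** The value at 0 is [g0]; the values at basis vectors then give [T]. *)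
Lemma lower_metric_inj (t t' : @tensors K n) :
  lower_metric t = lower_metric t' -> t = t'.
Proof.
move=> tt'; have entry u i j : lower_metric t u i j = lower_metric t' u i j.
  by rewrite tt'.
have zero (s : @tensors K n) i j : lower_metric s 0 i j = s.2 i j.
  by rewrite mxE big1 ?add0r // => k _; rewrite mxE mulr0.
have g0 i j : t.2 i j = t'.2 i j by rewrite -!zero entry.
case: t t' {tt' zero} entry g0 => [T g] [T' g'] /= entry g0; congr (_, _).
  apply/funext => i; apply/funext => j; apply/funext => k.
  have := entry (delta_mx k 0) i j; rewrite !mxE /= g0 => /addIr.
  rewrite (bigD1 k) //= [in RHS](bigD1 k) //= !mxE !eqxx !mulr1.
  by rewrite !big1 ?addr0 // => l /negPf lk; rewrite mxE lk mulr0.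
by apply/funext => i; apply/funext => j.
Qed.

(** [invmx] is involutive on all matrices, since it fixes the singular ones. *)
Lemma upper_metric_inj (t t' : @tensors K n) :
  upper_metric t = upper_metric t' -> t = t'.
Proof.
move=> tt'; apply: lower_metric_inj; apply/funext => u.
have := congr1 (fun g => invmx (g u)) tt'.
by rewrite /upper_metric !invmxK.
Qed.

Lemma upper_metric_unit (t : @tensors K n) u :
  (upper_metric t u \in unitmx) = (lower_metric t u \in unitmx).
Proof. exact: unitmx_inv. Qed.

(** Turns the rank into a polynomial condition: for any other [C'], a nonzero determinant of
    [P *m C' *m Q] forces rank at least [n]. *)
Lemma full_rank_minor (C : 'M[K]_(n + 1)) : \rank C = n ->
  exists (P : 'M_(n, n + 1)) (Q : 'M_(n + 1, n)), P *m C *m Q = 1%:M.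
Proof.
move=> rC; exists (pid_mx n *m invmx (col_ebase C)).
exists (invmx (row_ebase C) *m pid_mx n).
rewrite -[in X in _ *m X *m _](mulmx_ebase C) rC !mulmxA.
rewrite mulmxKV ?col_ebase_unit // mulmxK ?row_ebase_unit //.
by rewrite !pid_mx_id ?leq_addr // pid_mx_1.
Qed.

Lemma homog_scale (U : H) : U (rshift n 0) 0 != 0 ->
  U = U (rshift n 0) 0 *: homog ((U (rshift n 0) 0)^-1 *: usubmx U).
Proof.
move=> U0; apply/matrixP => i j; rewrite ord1 mxE.
case: (split_ordP i) => k -> /=; rewrite /homog ?col_mxEu ?col_mxEd.
  by rewrite !mxE mulVKf.
by rewrite !ord1 mxE eqxx mulr1.
Qed.

(** Starting from [U0], the determinant attesting rank at least [n] and the last coordinate are both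
    polynomial along lines, so some [U] makes both nonzero. Rescaling [U] to last coordinate 1
    multiplies the contraction by a nonzero scalar only. *)
Lemma nondegenerate_regular om : three_forms om ->
  (exists U, \rank (form_contract om U) = n) <->
  (exists u, lower_metric (tensors_of_form om) u \in unitmx).
Proof.
move=> h; split=> [[U0 /full_rank_minor[P [Q PCQ]]]|[u Gu]]; last first.
  by exists (homog u); rewrite rank_contract_homog // mxrank_unit.
have line_det : line_polynomial (fun U => \det (P *m form_contract om U *m Q)).
  apply: (@line_polynomial_det _ _ _ _ (fun U => P *m form_contract om U *m Q)).
  move=> U U' t; rewrite addrC form_contract_linear // mulmxDr mulmxDl addrC.
  by rewrite -scalemxAr -scalemxAl.
have line_last : line_polynomial (fun U : H => U (rshift n 0) 0).
  move=> U U'; exists ((U (rshift n 0) 0)%:P + 'X * (U' (rshift n 0) 0)%:P).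
  by move=> t; rewrite !mxE !hornerE.
have [||U] := line_polynomial_neq0 line_det line_last.
- by exists U0; rewrite PCQ det1 oner_neq0.
- by exists (delta_mx (rshift n 0) 0); rewrite mxE !eqxx oner_neq0.
rewrite mulf_eq0 negb_or => /andP[detU lastU].
set u := (U (rshift n 0) 0)^-1 *: usubmx U; exists u.
rewrite -row_full_unit /row_full eqn_leq rank_leq_row /=.
rewrite -(rank_contract_homog u h) -(mxrank_scale_nz _ lastU) -form_contractZ //.
rewrite -homog_scale //.
rewrite -[X in (X <= _)%N](mxrank_unit (A := P *m form_contract om U *m Q)).
  by rewrite (leq_trans (mxrankM_maxl _ _)) // mxrankM_maxr.
by rewrite unitmxE unitfE.
Qed.

Lemma nondegenerateE om : nondegenerate_three_forms om <->
  three_forms om /\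
  exists u, lower_metric (tensors_of_form om) u \in unitmx.
Proof.
split=> [[h rk]|[h reg]]; split=> //.
  exact: (nondegenerate_regular h).1.
exact: (nondegenerate_regular h).2.
Qed.

Lemma forms_operators_bij :
  set_bij (@nondegenerate_three_forms K n) hamiltonian_operators
    operator_of_form.
Proof.
have [bij1 bij2 bij3] := @forms_tensors_bij K n; split.
- move=> om /nondegenerateE[h [u Gu]]; exists (tensors_of_form om).
  by split=> //; [exact: bij1|exists u; rewrite upper_metric_unit].
- move=> om om' /set_mem/nondegenerateE[h _] /set_mem/nondegenerateE[h' _].
  by move=> /upper_metric_inj; apply: bij2; rewrite inE.
- move=> g [t [/bij3[om h <-] -> [u]]]; rewrite upper_metric_unit => Gu.
  by exists om => //; apply/nondegenerateE; split => //; exists u.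
Qed.

Lemma form_actionP a om : three_forms om -> three_forms (form_action a om).
Proof.
case=> l1 l2 l3 a1 a2; split=> //.
- by move=> Y Z c X X'; rewrite /form_action linearP l1.
- by move=> Y Z c X X'; rewrite /form_action linearP l2.
- by move=> Y Z c X X'; rewrite /form_action linearP l3.
- by move=> X Z; exact: a1.
- by move=> X Y; exact: a2.
Qed.

(** [form_action a om] takes on [a U], [a X], [a Y] the value of [om] on [U], [X], [Y]. *)
Lemma form_contract_action a om U : a \in unitmx -> three_forms om ->
  a^T *m form_contract (form_action a om) (a *m U) *m a = form_contract om U.
Proof.
move=> ua h; have h' := form_actionP a h.
apply/matrixP => i j.
transitivity (form_action a om (a *m U) (a *m delta_mx i 0) (a *m delta_mx j 0)).
  rewrite form_contractE // trmx_mul trmx_delta; set M := form_contract _ _.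
  have -> : delta_mx 0 i *m a^T *m M *m (a *m delta_mx j 0) =
            col j (row i (a^T *m M *m a)).
    by rewrite colE rowE !mulmxA.
  by rewrite [RHS]mxE [RHS]mxE.
by rewrite /form_action !mulKmx // mxE.
Qed.

Lemma nondegenerate_action a om : a \in unitmx ->
  nondegenerate_three_forms om ->
  nondegenerate_three_forms (form_action a om).
Proof.
move=> ua [h [U rU]]; split; first exact: form_actionP.
exists (a *m U); rewrite -[RHS]rU -/(form_contract om U) -/(form_contract _ (a *m U)).
rewrite -(form_contract_action U ua h).
rewrite mxrankMfree ?row_free_unit //.
by rewrite (eqmxMfull _ (_ : row_full a^T)) // row_full_unit unitmx_tr.
Qed.

End Operators.

(** * Projective maps in homogeneous coordinates, and the transformation of metrics *)

Section ProjectiveMaps.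
Context {K : numFieldType} {n : nat}.
Local Notation V := 'cV[K]_n.
Local Notation H := 'cV[K]_(n + 1).
Implicit Types (om : H -> H -> H -> K) (a : 'M[K]_(n + 1)) (u v : V).

Lemma reciprocal_factorE a u :
  reciprocal_factor a u = (dlsubmx a *m u) 0 0 + drsubmx a 0 0.
Proof.
rewrite /reciprocal_factor !mxE; congr (_ + _).
by apply: eq_bigr => j _; rewrite !mxE.
Qed.

Lemma projective_mapE a u :
  projective_map a u =
  (reciprocal_factor a u)^-1 *: (ulsubmx a *m u + ursubmx a).
Proof.
apply/matrixP => i j; rewrite !mxE ord1 mulrC; congr (_ * (_ + _)).
by apply: eq_bigr => k _; rewrite !mxE.
Qed.

(** The projective map is the linear map [a] read in the affine chart of last coordinate 1. *)
Lemma mul_homog a u : reciprocal_factor a u != 0 ->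
  a *m homog u = reciprocal_factor a u *: homog (projective_map a u).
Proof.
move=> A0; rewrite /homog -[a in LHS]submxK mul_block_col !mulmx1.
rewrite scale_col_mx projective_mapE scalerA divff // scale1r; congr col_mx.
apply/matrixP => i j; rewrite !ord1 reciprocal_factorE.
by rewrite [LHS]mxE [RHS]mxE [1%:M _ _]mxE eqxx mulr1.
Qed.

(* The differential of [projective_map a] at [u] is [tangent_map a u] divided
   by [reciprocal_factor a u]. *)
Definition tangent_map a u : 'M[K]_n :=
  ulsubmx a - projective_map a u *m dlsubmx a.

Lemma det_tangent_map a u : reciprocal_factor a u != 0 ->
  reciprocal_factor a u * \det (tangent_map a u) = \det a.
Proof.
move=> A0; have aE := mul_homog A0.
have dQ v : \det (block_mx 1%:M v 0 1%:M : 'M[K]_(n + 1)) = 1.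
  by rewrite det_ublock !det1 mulr1.
have : a *m block_mx 1%:M u 0 1%:M =
    block_mx 1%:M (projective_map a u) 0 1%:M *m
    block_mx (tangent_map a u) 0 (dlsubmx a) (reciprocal_factor a u)%:M.
  move: aE; rewrite /homog -[a in LHS]submxK mul_block_col scale_col_mx.
  move=> /eq_col_mx[top bot].
  rewrite -[a in LHS]submxK !mulmx_block top bot.
  rewrite !(mulmx0, mulmx1, mul1mx, mul0mx, addr0, add0r).
  by rewrite subrK mul_mx_scalar scalemx1.
move=> /(congr1 (fun M => \det M)); rewrite !det_mulmx !dQ mulr1 mul1r => ->.
by rewrite det_lblock det_scalar1 mulrC.
Qed.

Lemma tangent_map_unit a u : a \in unitmx -> reciprocal_factor a u != 0 ->
  tangent_map a u \in unitmx.
Proof.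
move=> + A0; rewrite !unitmxE !unitfE -(det_tangent_map A0).
by rewrite mulf_eq0 negb_or => /andP[].
Qed.

(** Contracting with [a *m homog u], a multiple of the lift of the image, produces the scalar. The
    first [n] columns of [a] agree with [tangent_map a u] modulo that lift, which lies in the kernel
    of the contracted form. *)
Lemma tangent_map_congruence a om u : a \in unitmx -> three_forms om ->
  reciprocal_factor a u != 0 ->
  (tangent_map a u)^T *m
    lower_metric (tensors_of_form (form_action a om)) (projective_map a u) *m
    tangent_map a u =
  (reciprocal_factor a u)^-1 *: lower_metric (tensors_of_form om) u.
Proof.
move=> ua h A0; have h' := form_actionP a h.
rewrite !lower_metric_contract // -(form_contract_action (homog u) ua h).
rewrite mul_homog // form_contractZ // -scalemxAr -scalemxAl.
set C := form_contract _ _; set A := reciprocal_factor a u.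
have C0 : C *m homog (projective_map a u) = 0 by exact: form_contract_self.
have C0l : (homog (projective_map a u))^T *m C = 0 by exact: form_contract_selfl.
have ulE (M : 'M[K]_(n + 1)) : ulsubmx M =
    (col_mx 1%:M 0)^T *m M *m (col_mx 1%:M 0 : 'M_(n + 1, n)).
  rewrite -[in RHS](submxK M) tr_col_mx trmx1 trmx0 mul_row_block mul_row_col.
  by rewrite !(mulmx1, mul1mx, mulmx0, mul0mx, addr0).
have aE : a *m col_mx 1%:M 0 = col_mx (tangent_map a u) 0 +
    homog (projective_map a u) *m dlsubmx a.
  rewrite -[a in LHS]submxK mul_block_col !mulmx1 !mulmx0 !addr0 /homog.
  by rewrite mul_col_mx mul1mx add_col_mx add0r subrK.
have -> : ulsubmx (A *: (a^T *m C *m a)) = A *: ulsubmx (a^T *m C *m a).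
  by apply/matrixP => i j; rewrite !mxE.
rewrite scalerA mulVf // scale1r [in RHS]ulE.
have -> : (col_mx 1%:M 0)^T *m (a^T *m C *m a) *m col_mx 1%:M 0 =
    (a *m col_mx 1%:M 0)^T *m C *m (a *m (col_mx 1%:M 0 : 'M_(n + 1, n))).
  by rewrite trmx_mul !mulmxA.
rewrite aE; set X := col_mx _ 0; set Y := homog _ *m _.
have CY : C *m Y = 0 by rewrite mulmxA C0 mul0mx.
have YC : Y^T *m C = 0 by rewrite trmx_mul -mulmxA C0l mulmx0.
have -> : (X + Y)^T *m C = X^T *m C.
  by rewrite [(X + Y)^T]raddfD mulmxDl YC addr0.
have -> : X^T *m C *m (X + Y) = X^T *m C *m X.
  by rewrite mulmxDr -[X^T *m C *m Y]mulmxA CY mulmx0 addr0.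
rewrite /X.
rewrite -[C in RHS]submxK tr_col_mx trmx0 mul_row_block mul_row_col.
by rewrite !(mulmx0, mul0mx, addr0).
Qed.

Lemma lower_metric_action_unit a om u : a \in unitmx -> three_forms om ->
  reciprocal_factor a u != 0 ->
  (lower_metric (tensors_of_form (form_action a om)) (projective_map a u)
    \in unitmx) = (lower_metric (tensors_of_form om) u \in unitmx).
Proof.
move=> ua h A0; have Au : (reciprocal_factor a u)^-1 \is a GRing.unit.
  by rewrite unitfE invr_eq0.
rewrite -[RHS](unitmxZ _ Au) -tangent_map_congruence // !unitmx_mul unitmx_tr.
by rewrite tangent_map_unit // andbT.
Qed.

(* The two vectors are the [w] and [w'] with
   [P psi = d_x w] and [P' psi' = A^-1 d_x w'], where [p' = d_x psi'] and
   [d_x psi = B^T d_x psi']. *)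
Lemma upper_metric_transform a om u (p' : V) : a \in unitmx ->
  three_forms om -> reciprocal_factor a u != 0 ->
  lower_metric (tensors_of_form om) u \in unitmx ->
  operator_of_form (form_action a om) (projective_map a u) *m
    ((reciprocal_factor a u)^-1 *: p') =
  tangent_map a u *m
    (operator_of_form om u *m ((tangent_map a u)^T *m p')).
Proof.
move=> ua h A0 Gu; have Bu := tangent_map_unit ua A0.
have G'u := Gu; rewrite -(lower_metric_action_unit ua h A0) in G'u.
have cong := tangent_map_congruence ua h A0.
rewrite /operator_of_form /upper_metric.
set G' := lower_metric _ (projective_map a u) in G'u cong *.
set G := lower_metric _ u in Gu cong *; set B := tangent_map a u in Bu cong *.
set w := invmx G *m _.
(* After multiplication by [B^T], the congruence replaces [B^T G' B] by [A^-1 G], and [G] cancels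
   its inverse inside [w]. *)
suff -> : (reciprocal_factor a u)^-1 *: p' = G' *m (B *m w) by rewrite mulKmx.
apply: (can_inj (mulKmx (_ : B^T \in unitmx))); first by rewrite unitmx_tr.
have -> : B^T *m (G' *m (B *m w)) = B^T *m G' *m B *m w by rewrite !mulmxA.
by rewrite cong -scalemxAl /w mulKVmx // -scalemxAr.
Qed.

End ProjectiveMaps.

(** * Derivatives and differentiability of matrix-valued functions *)

Section MatrixCalculus.
Context {K : numFieldType} {V : normedModType K}.

(** By linearity and continuity, [L] passes through the limit of the difference quotients along
    [v]. *)
Lemma is_derive_linear (W W' : normedModType K) (L : {linear W -> W'})
    (f : V -> W) x v df : continuous L ->
  is_derive x v f df -> is_derive x v (fun y => L (f y) : W') (L df).
Proof.
move=> cL [/cvg_ex[l fl] <-].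
have -> : 'D_v f x = l by apply: cvg_lim => //; exact: fl.
have Lfl : (fun h : K => h^-1 *: ((L (f (h *: v + x)) : W') - L (f x)))
    @ 0^' --> (L l : W').
  rewrite (_ : (fun h => _) =
    L \o (fun h => h^-1 *: ((f \o shift x) (h *: v) - f x))).
    exact: (cvg_comp _ _ fl (cL l)).
  by apply/funext => h /=; rewrite linearZ_LR [L (_ - _)]linearB.
split; first by apply/cvg_ex; exists (L l).
by apply: cvg_lim => //; exact: Lfl.
Qed.

Lemma is_derive_entry m n (M : V -> 'M[K]_(m, n)) x v (dM : 'M[K]_(m, n)) i j :
  is_derive x v M dM -> is_derive x v (fun y => M y i j) (dM i j).
Proof.
have @f : {linear 'M[K]_(m, n) -> K}.
  by exists (fun N : 'M[K]_(_, _) => N i j); do 2![eexists]; do ?[constructor];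
     rewrite ?mxE// => ? *; rewrite ?mxE//; move=> ?; rewrite !mxE.
have cf : continuous f by move=> N; exact: coord_continuous.
move=> hM; exact: (is_derive_linear cf hM).
Qed.

Lemma differentiable_entry m n (M : V -> 'M[K]_(m, n)) x i j :
  differentiable M x -> differentiable (fun y => M y i j) x.
Proof.
move=> dM; have dN := @differentiable_coord K m n (M x) i j.
exact: (differentiable_comp dM dN).
Qed.

Lemma mx_funE m n (M : V -> 'M[K]_(m, n)) :
  M = \sum_i \sum_j (fun y => M y i j *: delta_mx i j).
Proof.
apply/funext => y; rewrite fct_sumE {1}[M y]matrix_sum_delta.
by apply: eq_bigr => i _; rewrite fct_sumE.
Qed.

Lemma differentiable_mx m n (M : V -> 'M[K]_(m, n)) x :
  (forall i j, differentiable (fun y => M y i j) x) -> differentiable M x.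
Proof.
move=> dM; rewrite (mx_funE M); apply: differentiable_sum => i.
by apply: differentiable_sum => j; apply: differentiableZl.
Qed.

Lemma is_derive_scalel (W : normedModType K) (f : V -> K) (w : W) x v df :
  is_derive x v f df -> is_derive x v (fun y => f y *: w) (df *: w).
Proof.
have lin : linear (fun k : K => k *: w).
  by move=> c k k'; rewrite scalerDl scalerA.
pose L : {linear K -> W} := HB.pack (fun k : K => k *: w)
  (GRing.isLinear.Build _ _ _ _ _ lin).
have cL : continuous L by move=> k; exact: scalel_continuous.
exact: (is_derive_linear cL).
Qed.

Lemma is_derive_mx m n (M : V -> 'M[K]_(m, n)) x v (dM : 'M[K]_(m, n)) :
  (forall i j, is_derive x v (fun y => M y i j) (dM i j)) -> is_derive x v M dM.
Proof.
move=> hM; rewrite (mx_funE M) [dM]matrix_sum_delta.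
apply: is_derive_sum => i; apply: is_derive_sum => j.
exact: is_derive_scalel.
Qed.

Lemma is_derive_mul (f g : V -> K) x v df dg :
  is_derive x v f df -> is_derive x v g dg ->
  is_derive x v (fun y => f y * g y) (f x * dg + df * g x).
Proof.
move=> hf hg; have := is_deriveM hf hg.
by rewrite [df * _]mulrC; apply.
Qed.

Lemma is_derive_inv (f : V -> K) x v df : f x != 0 ->
  is_derive x v f df -> is_derive x v (fun y => (f y)^-1) (- (f x) ^- 2 * df).
Proof.
move=> fx0 [fd <-]; apply: DeriveDef; first exact: derivableV.
by rewrite deriveV.
Qed.

Lemma is_derive_mulmx m n p (M : V -> 'M[K]_(m, n)) (N : V -> 'M[K]_(n, p))
    x v
    (dM : 'M[K]_(m, n)) (dN : 'M[K]_(n, p)) :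
  is_derive x v M dM -> is_derive x v N dN ->
  is_derive x v (fun y => M y *m N y) (M x *m dN + dM *m N x).
Proof.
move=> hM hN; apply: is_derive_mx => i j.
rewrite (_ : (fun y => _) = \sum_k (fun y => M y i k * N y k j)); last first.
  by apply/funext => y; rewrite fct_sumE mxE.
rewrite !mxE -big_split /=.
by apply: is_derive_sum => k; apply: is_derive_mul; exact: is_derive_entry.
Qed.

Lemma is_derive_scalemx m n (f : V -> K) (M : V -> 'M[K]_(m, n)) x v df
    (dM : 'M[K]_(m, n)) :
  is_derive x v f df -> is_derive x v M dM ->
  is_derive x v (fun y => f y *: M y) (f x *: dM + df *: M x).
Proof.
move=> hf hM; apply: is_derive_mx => i j.
rewrite (_ : (fun y => _) = fun y => f y * M y i j); last first.
  by apply/funext => y; rewrite mxE.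
by rewrite !mxE; apply: is_derive_mul => //; exact: is_derive_entry.
Qed.

Lemma is_derive_trmx m n (M : V -> 'M[K]_(m, n)) x v (dM : 'M[K]_(m, n)) :
  is_derive x v M dM -> is_derive x v (fun y => (M y)^T) dM^T.
Proof.
move=> hM; apply: is_derive_mx => i j.
rewrite (_ : (fun y => _) = fun y => M y j i); last first.
  by apply/funext => y; rewrite mxE.
by rewrite mxE; exact: is_derive_entry.
Qed.

Lemma differentiable_mul (f g : V -> K) x :
  differentiable f x -> differentiable g x ->
  differentiable (fun y => f y * g y) x.
Proof. exact: differentiableM. Qed.

Lemma differentiable_bigsum (I : Type) (r : seq I) (f : I -> V -> K) x :
  (forall i, differentiable (f i) x) ->
  differentiable (fun y => \sum_(i <- r) f i y) x.
Proof.
move=> df; elim: r => [|i r ih].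
  by under eq_fun do rewrite big_nil; exact: differentiable_cst.
by under eq_fun do rewrite big_cons; exact: differentiableD.
Qed.

Lemma differentiable_bigprod (I : Type) (r : seq I) (f : I -> V -> K) x :
  (forall i, differentiable (f i) x) ->
  differentiable (fun y => \prod_(i <- r) f i y) x.
Proof.
move=> df; elim: r => [|i r ih].
  by under eq_fun do rewrite big_nil; exact: differentiable_cst.
by under eq_fun do rewrite big_cons; exact: differentiable_mul.
Qed.

Lemma differentiable_mulmx m n p (M : V -> 'M[K]_(m, n))
    (N : V -> 'M[K]_(n, p)) x : differentiable M x -> differentiable N x ->
  differentiable (fun y => M y *m N y) x.
Proof.
move=> dM dN; apply: differentiable_mx => i j; under eq_fun do rewrite mxE.
apply: differentiable_bigsum => k.
by apply: differentiable_mul; exact: differentiable_entry.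
Qed.

Lemma differentiable_scalemx m n (f : V -> K) (M : V -> 'M[K]_(m, n)) x :
  differentiable f x -> differentiable M x ->
  differentiable (fun y => f y *: M y) x.
Proof.
move=> df dM; apply: differentiable_mx => i j; under eq_fun do rewrite mxE.
by apply: differentiable_mul => //; exact: differentiable_entry.
Qed.

Lemma differentiable_trmx m n (M : V -> 'M[K]_(m, n)) x :
  differentiable M x -> differentiable (fun y => (M y)^T) x.
Proof.
move=> dM; apply: differentiable_mx => i j; under eq_fun do rewrite mxE.
exact: differentiable_entry.
Qed.

Lemma differentiable_inv (f : V -> K) x : f x != 0 ->
  differentiable f x -> differentiable (fun y => (f y)^-1) x.
Proof. by move=> f0 df; exact: differentiableV. Qed.

Lemma differentiable_det n (M : V -> 'M[K]_n) x :
  differentiable M x -> differentiable (fun y => \det (M y)) x.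
Proof.
move=> dM; rewrite /determinant; apply: differentiable_bigsum => s.
apply: differentiable_mul; first exact: differentiable_cst.
by apply: differentiable_bigprod => i; exact: differentiable_entry.
Qed.

(** The first-order expansion at [x] transfers because both functions agree near [x] and at [x];
    uniqueness of the differential then identifies that of [g]. *)
Lemma near_eq_differentiable (W : normedModType K) (f g : V -> W) x :
  (\near x, f x = g x) -> differentiable f x -> differentiable g x.
Proof.
move=> fg /diff_locallyP[cdf df].
have {}df : g \o shift x = cst (g x) + 'd f x +o_ 0 id.
  apply/eqaddoP => e e0; move/eqaddoP : df => /(_ e e0).
  have : \forall h \near 0, f (h + x) = g (h + x).
    by move: fg; rewrite (near_shift 0 x) subr0.
  apply: filterS2 => h fgh /=.
  rewrite -[X in `|X| <= _ -> _]/(f (h + x) - (f x + 'd f x h)).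
  rewrite -[X in _ -> `|X| <= _]/(g (h + x) - (g x + 'd f x h)).
  by rewrite fgh (nbhs_singleton fg).
have dE := diff_unique cdf df.
by apply/diff_locallyP; rewrite dE.
Qed.

Lemma near_dist_lt (f : V -> K) x e :
  differentiable f x -> 0 < e -> \forall y \near x, `|f x - f y| < e.
Proof. by move=> /differentiable_continuous cf; exact: cvgr_dist_lt cf e. Qed.

Lemma near_unitmx n (M : V -> 'M[K]_n) x :
  differentiable M x -> M x \in unitmx -> \forall y \near x, M y \in unitmx.
Proof.
move=> /differentiable_det/differentiable_continuous cdet.
rewrite unitmxE unitfE => det0.
by apply: filterS (cvgr_neq0 _ cdet det0) => y; rewrite unitmxE unitfE.
Qed.

(** Near an invertible value [invmx] is the adjugate divided by the determinant; on singular
    matrices it is the identity, hence the detour through a neighbourhood. *)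
Lemma differentiable_invmx n (M : V -> 'M[K]_n) x :
  M x \in unitmx -> differentiable M x -> differentiable (fun y => invmx (M y)) x.
Proof.
move=> ux dM; have ddet := differentiable_det dM.
apply: (@near_eq_differentiable _ (fun y => (\det (M y))^-1 *: \adj (M y))).
  by apply: filterS (near_unitmx dM ux) => y uy; rewrite /invmx uy.
apply: differentiable_scalemx.
  by apply: differentiable_inv => //; move: ux; rewrite unitmxE unitfE.
apply: differentiable_mx => i j; under eq_fun do rewrite mxE.
rewrite /cofactor; apply: differentiable_mul; first exact: differentiable_cst.
apply: differentiable_det; apply: differentiable_mx => k l.
under eq_fun do rewrite !mxE; exact: differentiable_entry.
Qed.

End MatrixCalculus.

Lemma derive_gradient {K : numFieldType} {n : nat} (f : 'cV[K]_n -> K) y v :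
  differentiable f y -> 'D_v f y = (v^T *m gradient f y) 0 0.
Proof.
move=> df; rewrite deriveE // {1}[v]matrix_sum_delta linear_sum mxE.
apply: eq_bigr => i _; rewrite big_ord1 linearZ !mxE; congr (_ * _).
by rewrite deriveE.
Qed.

Lemma is_derive_chain {K : numFieldType} {U V W : normedModType K}
    (F : V -> W) (u : U -> V) x v du :
  differentiable u x -> is_derive x v u du -> differentiable F (u x) ->
  is_derive x v (fun y => F (u y)) ('D_du F (u x)).
Proof.
move=> ud [_ <-] dF.
have dFu : differentiable (F \o u) x by exact: differentiable_comp.
apply: DeriveDef; first exact/diff_derivable.
by rewrite -[X in 'D_v X x]/(F \o u) !deriveE // diff_comp.
Qed.

Section Holomorphic.
Context {K : numFieldType} {V W : normedModType K}.

Lemma holomorphic_differentiable (O : set V) (f : V -> W) x :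
  holomorphic O f -> O x -> differentiable f x.
Proof. by move=> /(_ 0%N)[df _]; exact: df. Qed.

Lemma holomorphic_derive (O : set V) (f : V -> W) v :
  holomorphic O f -> holomorphic O ('D_v f).
Proof. by move=> hf k; have [_ ] := hf k.+1; apply. Qed.

End Holomorphic.

(** * Calculus along a projective reciprocal transformation *)

Section Transformation.
Context {K : numFieldType} {n : nat}.
Local Notation V := 'cV[K]_n.
Variable a : 'M[K]_(n + 1).
Local Notation A := (reciprocal_factor a).
Local Notation phi := (projective_map a).
Local Notation B := (tangent_map a).
Local Notation c := (dlsubmx a).

Lemma is_derive_factor u v : is_derive u v A ((c *m v) 0 0).
Proof.
have -> : A = fun u => (c *m u) 0 0 + drsubmx a 0 0.
  by apply/funext => y; exact: reciprocal_factorE.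
have := is_derive_mulmx (is_derive_cst c u v) (is_derive_id u v).
rewrite mul0mx addr0 => /(@is_derive_entry _ _ _ _ _ _ _ _ 0 0) dcu.
have := is_deriveD dcu (is_derive_cst (drsubmx a 0 0) u v).
by rewrite addr0.
Qed.

Lemma differentiable_factor u : differentiable A u.
Proof.
have -> : A = fun u => (c *m u) 0 0 + drsubmx a 0 0.
  by apply/funext => y; exact: reciprocal_factorE.
apply: differentiableD; last exact: differentiable_cst.
by apply: differentiable_entry; apply: differentiable_mulmx.
Qed.

Lemma is_derive_projective_map u v : A u != 0 ->
  is_derive u v phi ((A u)^-1 *: (B u *m v)).
Proof.
move=> A0.
have -> : phi = fun u => (A u)^-1 *: (ulsubmx a *m u + ursubmx a).
  by apply/funext => y; exact: projective_mapE.
have dN : is_derive u v (fun y => ulsubmx a *m y + ursubmx a) (ulsubmx a *m v).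
  have := is_derive_mulmx (is_derive_cst (ulsubmx a) u v) (is_derive_id u v).
  rewrite mul0mx addr0 => dP.
  have := is_deriveD dP (is_derive_cst (ursubmx a) u v).
  by rewrite addr0.
have dphi := is_derive_scalemx (is_derive_inv A0 (is_derive_factor u v)) dN.
apply: (is_derive_eq dphi).
rewrite /tangent_map mulmxBl scalerBr; congr (_ + _).
rewrite -mulmxA [in RHS](mx11_scalar (c *m v)) mul_mx_scalar projective_mapE.
rewrite !scalerA -scaleNr; congr (_ *: _). by field.
Qed.

Lemma differentiable_projective_map u : A u != 0 -> differentiable phi u.
Proof.
move=> A0.
have -> : phi = fun u => (A u)^-1 *: (ulsubmx a *m u + ursubmx a).
  by apply/funext => y; exact: projective_mapE.
apply: differentiable_scalemx.
  by apply: differentiable_inv => //; exact: differentiable_factor.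
apply: differentiableD; last exact: differentiable_cst.
by apply: differentiable_mulmx => //; exact: differentiable_cst.
Qed.

Lemma differentiable_tangent_map u : A u != 0 -> differentiable B u.
Proof.
move=> A0; apply: differentiableB; first exact: differentiable_cst.
apply: differentiable_mulmx; last exact: differentiable_cst.
exact: differentiable_projective_map.
Qed.

(** In the product rule the factor [A] cancels the [A^-1] in the differential of [phi]; the second
    term comes from differentiating [A], whose linear part is [c]. *)
Lemma gradient_transform (f : V -> K) u : A u != 0 ->
  differentiable f (phi u) ->
  gradient (fun y => A y * f (phi y)) u =
  (B u)^T *m gradient f (phi u) + f (phi u) *: c^T.
Proof.
move=> A0 df; apply/matrixP => i j; rewrite ord1 mxE.
have dphi := differentiable_projective_map A0.
have := is_derive_mul (is_derive_factor u (delta_mx i 0))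
  (is_derive_chain dphi (is_derive_projective_map (delta_mx i 0) A0) df).
move=> /@derive_val ->; rewrite derive_gradient //.
rewrite [RHS]mxE; congr (_ + _).
  rewrite linearZ /= -scalemxAl mxE mulVKf // trmx_mul -mulmxA trmx_delta.
  by rewrite -rowE mxE.
by rewrite -colE !mxE mulrC.
Qed.

Definition hessian (f : V -> K) (y : V) : 'M[K]_n :=
  \matrix_(i, k) 'D_(delta_mx k 0) ('D_(delta_mx i 0) f) y.

Lemma gradient_fun (f : V -> K) i :
  (fun y => gradient f y i 0) = 'D_(delta_mx i 0) f.
Proof. by apply/funext => y; rewrite mxE. Qed.

Lemma differentiable_gradient (O : set V) (f : V -> K) y :
  holomorphic O f -> O y -> differentiable (gradient f) y.
Proof.
move=> hf Oy; apply: differentiable_mx => i j; rewrite ord1 gradient_fun.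
exact: (holomorphic_differentiable (holomorphic_derive _ hf) Oy).
Qed.

Lemma differentiable_hessian (O : set V) (f : V -> K) y :
  holomorphic O f -> O y -> differentiable (hessian f) y.
Proof.
move=> hf Oy; apply: differentiable_mx => i j.
under eq_fun do rewrite mxE.
have hf2 := holomorphic_derive (delta_mx j 0) (holomorphic_derive (delta_mx i 0) hf).
exact: (holomorphic_differentiable hf2 Oy).
Qed.

Lemma is_derive_gradient (O : set V) (f : V -> K) y v :
  holomorphic O f -> O y -> is_derive y v (gradient f) (hessian f y *m v).
Proof.
move=> hf Oy; apply: is_derive_mx => i j; rewrite ord1 gradient_fun.
have df := holomorphic_differentiable (holomorphic_derive (delta_mx i 0) hf) Oy.
apply: DeriveDef; first exact: diff_derivable.
rewrite derive_gradient // !mxE; apply: eq_bigr => k _.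
by rewrite !mxE mulrC.
Qed.

Lemma differentiable_lower_metric (t : @tensors K n) u :
  differentiable (lower_metric t) u.
Proof.
apply: differentiable_mx => i j; under eq_fun do rewrite mxE.
apply: differentiableD; last exact: differentiable_cst.
apply: differentiable_bigsum => k; apply: differentiable_mul.
  exact: differentiable_cst.
exact: differentiable_coord.
Qed.

Lemma differentiable_upper_metric (t : @tensors K n) u :
  upper_metric t u \in unitmx -> differentiable (upper_metric t) u.
Proof.
rewrite upper_metric_unit => Gu; apply: differentiable_invmx => //.
exact: differentiable_lower_metric.
Qed.

(** The weight of the measure cancels the [w^-1] of the outer derivation and leaves a plain
    derivative in [x]. *)
Lemma bracket_densityE w g (f h : V -> K) (u : K -> V) x : w x != 0 ->
  bracket_density w g f h u x * w x =
  ((gradient f (u x))^T *m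
   derive1 (fun y => g (u y) *m total_D w (fun z => gradient h (u z)) y) x) 0 0.
Proof.
move=> w0; rewrite /bracket_density mulr_suml mxE; apply: eq_bigr => i _.
by rewrite /apply_operator /total_D !mxE -mulrA mulrAC mulVf // mul1r.
Qed.

Lemma differentiable_jet m (X : set K) (u : K -> V) x : holomorphic X u ->
  X x -> differentiable (jet m u) x.
Proof.
move=> hu Xx; apply: differentiable_mx => i k.
have hk j : holomorphic X (derive1n j u).
  elim: j => [//|j ih]; rewrite derive1nS.
  have -> : derive1 (derive1n j u) = 'D_1 (derive1n j u).
    by apply/funext => y; rewrite derive1E.
  exact: holomorphic_derive.
under eq_fun do rewrite mxE; apply: differentiable_entry.
exact: (holomorphic_differentiable (hk k) Xx).
Qed.

End Transformation.

(** * The operator of the transformed form is a transform of the operator *)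

Section TransformedOperator.
Context {K : numFieldType} {n : nat}.
Local Notation V := 'cV[K]_n.
Local Notation H := 'cV[K]_(n + 1).
Variables (a : 'M[K]_(n + 1)) (om : H -> H -> H -> K).
Hypotheses (ua : a \in unitmx) (om3 : three_forms om).
Local Notation A := (reciprocal_factor a).
Local Notation phi := (projective_map a).
Local Notation B := (tangent_map a).
Local Notation c := (dlsubmx a).
Local Notation g := (operator_of_form om).
Local Notation g' := (operator_of_form (form_action a om)).

(* [g^ij d_x (d h / d u^j)] as a function of the 1-jet of [u], where
   [h = A h'] *)
Let flux (h' : V -> K) (J : 'M[K]_(n, 2)) : V :=
  let u := col 0 J in
  g u *m ((B u)^T *m
    (hessian h' (phi u) *m ((A u)^-1 *: (B u *m col 1 J)))).

Let potential (f' h' : V -> K) (J : 'M[K]_(n, 2)) : K :=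
  f' (phi (col 0 J)) * (c *m flux h' J) 0 0.

Let domain (O : set V) : set V :=
  [set u | [/\ A u != 0, g u \in unitmx, g' (phi u) \in unitmx & O (phi u)]].

Let differentiable_col m p (j : 'I_p) (J : 'M[K]_(m, p)) :
  differentiable (fun M : 'M[K]_(m, p) => col j M) J.
Proof.
apply: differentiable_mx => i k; under eq_fun do rewrite mxE.
exact: differentiable_coord.
Qed.

Let differentiable_flux O h' J : holomorphic O h' -> domain O (col 0 J) ->
  differentiable (flux h') J.
Proof.
move=> hh [A0 gu g'u Ou].
have d0 := differentiable_col 0 J; have d1 := differentiable_col 1 J.
have dphi : differentiable (fun M : 'M[K]_(n, 2) => phi (col 0 M)) J.
  by apply: (differentiable_comp d0); exact: differentiable_projective_map.
have dB : differentiable (fun M : 'M[K]_(n, 2) => B (col 0 M)) J.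
  by apply: (differentiable_comp d0); exact: differentiable_tangent_map.
apply: differentiable_mulmx.
  by apply: (differentiable_comp d0); exact: differentiable_upper_metric.
apply: differentiable_mulmx; first exact: differentiable_trmx.
apply: differentiable_mulmx.
  by apply: (differentiable_comp dphi); exact: (differentiable_hessian hh Ou).
apply: differentiable_scalemx; last exact: differentiable_mulmx.
apply: differentiable_inv => //.
by apply: (differentiable_comp d0); exact: differentiable_factor.
Qed.

Let differentiable_potential O f' h' J :
  holomorphic O f' -> holomorphic O h' -> domain O (col 0 J) ->
  differentiable (potential f' h') J.
Proof.
move=> hf hh dJ; have [A0 gu g'u Ou] := dJ.
have d0 := differentiable_col 0 J.
have dphi : differentiable (fun M : 'M[K]_(n, 2) => phi (col 0 M)) J.
  by apply: (differentiable_comp d0); exact: differentiable_projective_map.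
apply: differentiable_mul.
  by apply: (differentiable_comp dphi); exact: (holomorphic_differentiable hf Ou).
apply: differentiable_entry; apply: differentiable_mulmx.
  exact: differentiable_cst.
exact: (differentiable_flux hh).
Qed.

Let jet_col0 m (u : K -> V) x : col 0 (jet m u x) = u x.
Proof. by apply/matrixP => i j; rewrite !mxE ord1. Qed.

Let jet_col1 (u : K -> V) x : col 1 (jet 1 u x) = derive1 u x.
Proof. by apply/matrixP => i j; rewrite !mxE ord1. Qed.

(** In the application [M] is [B], [G] the gradient of [f'], [t] the velocity of [phi u], [v] the
    vector [w], [v1] its derivative and [s] the value of [f']. On the left stands the derivative of
    [f' (c w)], on the right the difference of the two integrands. *)
Let potential_algebra (M : 'M[K]_n) (G t v v1 : V) (s : K) :
  s * (c *m v1) 0 0 + (t^T *m G) 0 0 * (c *m v) 0 0 =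
  ((M^T *m G + s *: c^T)^T *m v1) 0 0 - (G^T *m (M *m v1 - t *m c *m v)) 0 0.
Proof.
have -> : (M^T *m G + s *: c^T)^T = G^T *m M + s *: c.
  by rewrite [LHS]raddfD /= trmx_mul trmxK linearZ /= trmxK.
rewrite mulmxDl mulmxBr -scalemxAl -mulmxA.
have -> : G^T *m (t *m c *m v) = (t^T *m G) 0 0 *: (c *m v).
  rewrite -mulmxA mulmxA [G^T *m t]mx11_scalar mul_scalar_mx; congr (_ *: _).
  have -> : t^T *m G = (G^T *m t)^T by rewrite trmx_mul trmxK.
  by rewrite [RHS]mxE.
set X := G^T *m _; set Y := c *m v1; set Z := c *m v; set r := (_ *m G) 0 0.
by rewrite !mxE; ring.
Qed.

Theorem reciprocal_transform_form_action : reciprocal_transform a g g'.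
Proof.
move=> O f' h' oO hf hh f h; exists 1%N, (potential f' h').
split=> [J dJ|X u oX hu uX x Xx]; first exact: (differentiable_potential hf hh dJ).
have uD y : X y -> domain O (u y) by exact: uX.
have duy y : X y -> differentiable u y.
  by move=> Xy; exact: (holomorphic_differentiable hu Xy).
have du1 y : X y -> is_derive y (1 : K) u (derive1 u y).
  move=> Xy; rewrite derive1E; apply: DeriveDef => //.
  by apply: diff_derivable; exact: duy.
pose tu y := phi (u y).
pose tu' y := (A (u y))^-1 *: (B (u y) *m derive1 u y).
have dtu y : X y -> is_derive y (1 : K) tu (tu' y).
  move=> Xy; have [A0 _ _ _] := uD y Xy.
  have dphi := is_derive_projective_map (derive1 u y) A0.
  have := is_derive_chain (duy _ Xy) (du1 _ Xy) (differentiable_projective_map A0).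
  by rewrite (@derive_val _ _ _ _ _ _ _ dphi).
have dtuy y : X y -> differentiable tu y.
  by move=> Xy; apply/derivable1_diffP; have [] := dtu y Xy.
pose p' y := hessian h' (tu y) *m tu' y.
have dpsi' y : X y -> is_derive y (1 : K) (fun z => gradient h' (tu z)) (p' y).
  move=> Xy; have [_ _ _ Oy] := uD y Xy.
  have dg := is_derive_gradient (tu' y) hh Oy.
  have := is_derive_chain (dtuy _ Xy) (dtu _ Xy) (differentiable_gradient hh Oy).
  by rewrite (@derive_val _ _ _ _ _ _ _ dg).
have dval (k : V -> K) y : holomorphic O k -> X y ->
    is_derive y (1 : K) (fun z => k (tu z)) (((tu' y)^T *m gradient k (tu y)) 0 0).
  move=> hk Xy; have [_ _ _ Oy] := uD y Xy.
  have dk := holomorphic_differentiable hk Oy.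
  have := is_derive_chain (dtuy _ Xy) (dtu _ Xy) dk.
  by rewrite derive_gradient.
have dB y : X y -> is_derive y (1 : K) (fun z => B (u z)) (- (tu' y *m c)).
  move=> Xy.
  have := is_deriveB (is_derive_cst (ulsubmx a) y (1 : K))
    (is_derive_mulmx (dtu _ Xy) (is_derive_cst c y (1 : K))).
  by rewrite mulmx0 !add0r.
have psiE y : X y -> gradient h (u y) =
    (B (u y))^T *m gradient h' (tu y) + h' (tu y) *: c^T.
  move=> Xy; have [A0 _ _ Oy] := uD y Xy.
  by rewrite gradient_transform //; exact: (holomorphic_differentiable hh Oy).
have nearX y : X y -> \near y, X y by move=> Xy; exact: open_nbhs_nbhs.
(* Differentiating [B^T] gives [- c^T] times the derivative of [h'] along the curve, which cancels
   the term coming from [h' c^T]. *)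
have dpsi y : X y -> derive1 (fun z => gradient h (u z)) y = (B (u y))^T *m p' y.
  move=> Xy; rewrite derive1E; apply: (@derive_val _ _ _ _ _ _ _ _).
  apply: (@near_eq_is_derive _ _ _
    (fun z => (B (u z))^T *m gradient h' (tu z) + h' (tu z) *: c^T)).
    by apply: filterS (nearX y Xy) => z Xz; rewrite psiE.
  have := is_deriveD (is_derive_mulmx (is_derive_trmx (dB _ Xy)) (dpsi' _ Xy))
    (is_derive_scalemx (dval h' y hh Xy) (is_derive_cst c^T y (1 : K))).
  move=> dd; apply: (is_derive_eq dd).
  rewrite scaler0 add0r -addrA -[RHS]addr0; congr (_ + _).
  rewrite linearN /= trmx_mul mulNmx -mulmxA.
  set s := _ *m gradient _ _; rewrite [in X in - X](mx11_scalar s).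
  by rewrite mul_mx_scalar addNr.
pose w y := g (u y) *m total_D (fun=> 1) (fun z => gradient h (u z)) y.
pose w' y := g' (tu y) *m total_D (A \o u) (fun z => gradient h' (tu z)) y.
have wE y : X y -> w y = g (u y) *m ((B (u y))^T *m p' y).
  by move=> Xy; rewrite /w /total_D invr1 scale1r dpsi.
have w'E y : X y -> w' y = B (u y) *m w y.
  move=> Xy; have [A0 gu g'u Oy] := uD y Xy.
  rewrite wE // /w' /total_D derive1E (@derive_val _ _ _ _ _ _ _ (dpsi' y Xy)).
  by apply: upper_metric_transform => //; rewrite -upper_metric_unit.
have wJ y : X y -> w y = flux h' (jet 1 u y).
  by move=> Xy; rewrite wE // /flux jet_col0 jet_col1.
(* [w] already contains a derivative of [u]; it is derivable because near [x] it is [flux h']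
   composed with the 1-jet. *)
have dw : derivable w x (1 : K).
  apply/derivable1_diffP; apply: (@near_eq_differentiable _ _ _ (flux h' \o jet 1 u)).
    by apply: filterS (nearX x Xx) => z Xz; rewrite /= wJ.
  apply: differentiable_comp; first exact: (differentiable_jet _ hu Xx).
  by apply: (differentiable_flux hh); rewrite jet_col0; exact: uD.
have {}dw := derivableP dw; set w1 := 'D_1 w x in dw.
have dw' : derive1 w' x = B (u x) *m w1 - tu' x *m c *m w x.
  rewrite derive1E; apply: (@derive_val _ _ _ _ _ _ _ _).
  apply: (@near_eq_is_derive _ _ _ (fun z => B (u z) *m w z)).
    by apply: filterS (nearX x Xx) => z Xz; rewrite w'E.
  by have := is_derive_mulmx (dB _ Xx) dw; rewrite mulNmx.
have [A0 gu g'u Ox] := uD x Xx.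
have e1 : bracket_density (fun=> 1) g f h u x =
    ((gradient f (u x))^T *m w1) 0 0.
  have := @bracket_densityE _ _ (fun=> 1) g f h u x (oner_neq0 K).
  by rewrite mulr1 /w1 -derive1E.
have e2 : bracket_density (A \o u) g' f' h' tu x * A (u x) =
    ((gradient f' (tu x))^T *m derive1 w' x) 0 0.
  exact: (@bracket_densityE _ _ (A \o u) g' f' h' tu x A0).
rewrite [LHS](congr2 (fun s t => s - t) e1 e2) dw'.
have -> : gradient f (u x) =
    (B (u x))^T *m gradient f' (tu x) + f' (tu x) *: c^T.
  by rewrite gradient_transform //; exact: (holomorphic_differentiable hf Ox).
rewrite [RHS]derive1E; symmetry; apply: (@derive_val _ _ _ _ _ _ _ _).
apply: (@near_eq_is_derive _ _ _ (fun z => f' (tu z) * (c *m w z) 0 0)).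
  apply: filterS (nearX x Xx) => z Xz.
  by rewrite /potential jet_col0 wJ.
have dcw := is_derive_mulmx (is_derive_cst c x (1 : K)) dw.
have := is_derive_mul (dval f' x hf Xx) (is_derive_entry 0 0 dcw).
move=> dd; apply: (is_derive_eq dd).
rewrite mul0mx addr0; exact: potential_algebra.
Qed.

End TransformedOperator.

(** * Two transforms of one operator, tested on quadratic densities *)

Section Uniqueness.
Context {K : numFieldType} {n : nat}.
Local Notation V := 'cV[K]_n.

(** Test densities: the gradient of the [j]-th one stays on the [j]-th axis, and pairing with that
    of the [i]-th one isolates the entry [(i, j)] of the metric. *)
Let square (i : 'I_n) (y : V) : K := y i 0 * y i 0.

Lemma is_derive_coord (y v : V) i : is_derive y v (fun z => z i 0) (v i 0).
Proof. exact: (is_derive_entry i 0 (is_derive_id y v)). Qed.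

Lemma holomorphic_upto_cst (W : normedModType K) (O : set V) k (w : W) :
  holomorphic_upto k O (fun _ : V => w).
Proof.
elim: k w => [|k ih] w.
  by split=> // y _; exact: differentiable_cst.
split=> [y _|v]; first exact: differentiable_cst.
suff -> : 'D_v (fun _ : V => w) = fun=> 0 by exact: ih.
by apply/funext => y; exact: derive_cst.
Qed.

(** Differentiation lowers the degree, so two steps reach the constants. *)
Lemma holomorphic_square O i : holomorphic O (square i).
Proof.
have dE v : 'D_v (square i) = fun y => 2 * v i 0 * y i 0.
  apply/funext => y.
  have := is_derive_mul (is_derive_coord y v i) (is_derive_coord y v i).
  by move=> /@derive_val ->; ring.
have dE2 (r : K) v : 'D_v (fun y : V => r * y i 0) = fun=> r * v i 0.
  apply/funext => y.
  have := is_derive_mul (is_derive_cst r y v) (is_derive_coord y v i).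
  by move=> /@derive_val ->; rewrite mul0r addr0.
have diffl (r : K) (y : V) : differentiable (fun z : V => r * z i 0) y.
  apply: differentiable_mul; first exact: differentiable_cst.
  exact: differentiable_coord.
have holo_l (r : K) k : holomorphic_upto k O (fun y : V => r * y i 0).
  case: k => [|k]; split=> // v.
  by rewrite dE2; exact: holomorphic_upto_cst.
have dsq (y : V) : differentiable (square i) y.
  by apply: differentiable_mul; exact: differentiable_coord.
by case=> [|k]; split=> // v; rewrite dE; exact: holo_l.
Qed.

Lemma gradient_square i y :
  gradient (square i) y = (2 * y i 0) *: delta_mx i 0.
Proof.
apply/matrixP => k l; rewrite ord1 !mxE.
have := is_derive_mul (is_derive_coord y (delta_mx k 0) i)
  (is_derive_coord y (delta_mx k 0) i).
move=> /@derive_val ->; rewrite mxE !eqxx !andbT [k == i]eq_sym; ring.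
Qed.

Variables (a : 'M[K]_(n + 1)) (t t' t'' : @tensors K n).
Local Notation A := (reciprocal_factor a).
Local Notation phi := (projective_map a).
Local Notation g := (upper_metric t).

(** Along the line [y + rho e] the gradient of the [j]-th square has derivative [2 rho'] times a
    basis vector. The inner derivation adds the factor [A^-1], and the outer one becomes the
    derivative [F'] of a single scaled entry. *)
Let bracket_square s (rho rho' : K -> K) (X : set K) (u : K -> V) (y e : V)
    i j x :
  open X -> X x -> (forall z, X z -> A (u z) != 0) ->
  (forall z, X z -> differentiable u z) ->
  (forall z, X z -> upper_metric s (phi (u z)) \in unitmx) ->
  (forall z, X z -> phi (u z) = y + rho z *: e) ->
  (forall z, X z -> is_derive z (1 : K) rho (rho' z)) ->
  (forall z, X z -> differentiable rho' z) -> e i 0 = 1 -> e j 0 = 1 ->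
  exists2 F' : K,
    is_derive x (1 : K)
      (fun z => 2 * rho' z * (A (u z))^-1 * upper_metric s (phi (u z)) i j) F' &
    bracket_density (A \o u) (upper_metric s) (square i) (square j)
      (phi \o u) x * A (u x) = 2 * phi (u x) i 0 * F'.
Proof.
move=> oX Xx A0 du us phiE drho drho' ei ej.
have nearX z : X z -> \near z, X z by move=> Xz; exact: open_nbhs_nbhs.
pose w z := upper_metric s (phi (u z)) *m
  total_D (A \o u) (fun z => gradient (square j) (phi (u z))) z.
pose w0 z := (2 * rho' z * (A (u z))^-1) *:
  (upper_metric s (phi (u z)) *m (delta_mx j 0 : V)).
have wE z : X z -> w z = w0 z.
  move=> Xz; rewrite /w /w0 scalemxAr; congr (_ *m _).
  rewrite /total_D derive1E.
  have dg : is_derive z (1 : K)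
      (fun z => gradient (square j) (phi (u z))) ((2 * rho' z) *: (delta_mx j 0 : V)).
    apply: (@near_eq_is_derive _ _ _
      (fun z => (2 * (y j 0 + rho z)) *: (delta_mx j 0 : V))).
      apply: filterS (nearX z Xz) => r Xr.
      by rewrite gradient_square phiE // !mxE ej mulr1.
    have := is_derive_scalemx (is_derive_mul (is_derive_cst (2 : K) z (1 : K))
      (is_deriveD (is_derive_cst (y j 0) z (1 : K)) (drho z Xz)))
      (is_derive_cst (delta_mx j 0 : V) z (1 : K)).
    by move=> dd; apply: (is_derive_eq dd); rewrite scaler0 !add0r mul0r addr0.
  by rewrite (@derive_val _ _ _ _ _ _ _ dg) scalerA mulrC.
have dphi z : X z -> differentiable (fun r => phi (u r)) z.
  move=> Xz; apply: differentiable_comp; first exact: du.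
  exact: differentiable_projective_map (A0 z Xz).
have dA z : X z -> differentiable (fun r => A (u r)) z.
  by move=> Xz; apply: differentiable_comp; [exact: du|exact: differentiable_factor].
have dg z : X z -> differentiable (fun r => upper_metric s (phi (u r))) z.
  move=> Xz; apply: (differentiable_comp (dphi z Xz)).
  exact: differentiable_upper_metric (us z Xz).
have dw0 : derivable w0 x (1 : K).
  apply/derivable1_diffP; apply: differentiable_scalemx.
    apply: differentiable_mul; last by apply: differentiable_inv; [exact: A0|exact: dA].
    apply: differentiable_mul; first exact: differentiable_cst.
    exact: drho'.
  apply: differentiable_mulmx; first exact: dg.
  exact: differentiable_cst.
have {}dw0 := derivableP dw0; exists ('D_1 w0 x i 0).
  have := is_derive_entry i 0 dw0; congr is_derive.
  by apply/funext => z; rewrite /w0 mxE -colE mxE.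
have := @bracket_densityE _ _ (A \o u) (upper_metric s) (square i) (square j)
  (phi \o u) x (A0 x Xx).
rewrite /= => ->; rewrite -/w derive1E.
have -> : 'D_1 w x = 'D_1 w0 x.
  by apply: near_eq_derive; apply: filterS (nearX x Xx) => z Xz; rewrite wE.
by rewrite gradient_square linearZ /= trmx_delta -scalemxAl -rowE !mxE.
Qed.

(* For the densities [(y^i)^2] and [(y^j)^2], an integration by parts turns the
   difference of the two null functionals into [E'] below. *)
Lemma null_pair i j :
  reciprocal_transform a g (upper_metric t') ->
  reciprocal_transform a g (upper_metric t'') ->
  exists m, forall (X : set K) (u : K -> V) (rho rho' : K -> K) (y e : V),
    open X -> holomorphic X u ->
    (forall z, X z -> [/\ A (u z) != 0, g (u z) \in unitmx,
      upper_metric t' (phi (u z)) \in unitmx &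
      upper_metric t'' (phi (u z)) \in unitmx]) ->
    (forall z, X z -> phi (u z) = y + rho z *: e) ->
    (forall z, X z -> is_derive z (1 : K) rho (rho' z)) ->
    (forall z, X z -> differentiable rho' z) -> e i 0 = 1 -> e j 0 = 1 ->
    exists E : K -> K,
      (forall x, X x -> is_derive x (1 : K) E (4 * rho' x ^+ 2 / A (u x) *
        (upper_metric t' (phi (u x)) i j - upper_metric t'' (phi (u x)) i j)))
      /\ (forall x x', jet m u x = jet m u x' -> rho' x = 0 -> rho' x' = 0 ->
        E x = E x').
Proof.
move=> h' h''.
have [m' [q' [dq' Q']]] :=
  h' setT (square i) (square j) openT (holomorphic_square _ i) (holomorphic_square _ j).
have [m'' [q'' [dq'' Q'']]] :=
  h'' setT (square i) (square j) openT (holomorphic_square _ i) (holomorphic_square _ j).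
(* The two potentials may depend on jets of different orders. *)
exists (maxn m' m'') => X u rho rho' y e oX hu hX phiE drho drho' ei ej.
have jet_le p x x' : (p <= maxn m' m'')%N ->
    jet (maxn m' m'') u x = jet (maxn m' m'') u x' -> jet p u x = jet p u x'.
  move=> pm Jx; apply/matrixP => k l.
  have lp : (l < (maxn m' m'').+1)%N by rewrite (leq_trans (ltn_ord l)).
  by have /matrixP/(_ k (Ordinal lp)) := Jx; rewrite !mxE.
pose F s z := 2 * rho' z * (A (u z))^-1 * upper_metric s (phi (u z)) i j.
(* The bracket of [g] cancels in the difference of potentials. The last product trades [phi_i] times
   the derivative of [F] for [rho'] times [F], and it vanishes where [rho'] does. *)
exists (fun x => q' (jet m' u x) - q'' (jet m'' u x) +
  2 * phi (u x) i 0 * (F t' x - F t'' x)).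
split=> [x Xx|x x' Jx r0 r0']; last first.
  rewrite /F r0 r0' !(mulr0, mul0r, subr0, addr0).
  by rewrite (jet_le m' x x') ?(jet_le m'' x x') ?leq_maxl ?leq_maxr.
have A0 z : X z -> A (u z) != 0 by move=> /hX[].
have du z : X z -> differentiable u z.
  by move=> Xz; exact: (holomorphic_differentiable hu Xz).
have [F' dF' b'] := bracket_square (s := t') oX Xx A0 du
  (fun z Xz => let: And4 _ _ H _ := hX z Xz in H) phiE drho drho' ei ej.
have [F'' dF'' b''] := bracket_square (s := t'') oX Xx A0 du
  (fun z Xz => let: And4 _ _ _ H := hX z Xz in H) phiE drho drho' ei ej.
have [_ gu g'u g''u] := hX x Xx.
have col0 p z : col 0 (jet p u z) = u z.
  by apply/matrixP => k l; rewrite !mxE ord1.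
pose b := bracket_density (fun=> 1) g (fun y => A y * square i (phi y))
  (fun y => A y * square j (phi y)) u x.
have dQ' : is_derive x (1 : K) (fun z => q' (jet m' u z))
    (b - 2 * phi (u x) i 0 * F').
  rewrite -b' (Q' X) //; last by move=> z /hX[].
  rewrite derive1E; apply: derivableP; apply/derivable1_diffP.
  apply: differentiable_comp; first exact: (differentiable_jet _ hu Xx).
  by apply: dq'; rewrite col0; split => //; exact: A0.
have dQ'' : is_derive x (1 : K) (fun z => q'' (jet m'' u z))
    (b - 2 * phi (u x) i 0 * F'').
  rewrite -b'' (Q'' X) //; last by move=> z /hX[].
  rewrite derive1E; apply: derivableP; apply/derivable1_diffP.
  apply: differentiable_comp; first exact: (differentiable_jet _ hu Xx).
  by apply: dq''; rewrite col0; split => //; exact: A0.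
have nearX z : X z -> \near z, X z by move=> Xz; exact: open_nbhs_nbhs.
have dphi : is_derive x (1 : K) (fun z => 2 * phi (u z) i 0) (2 * rho' x).
  apply: (@near_eq_is_derive _ _ _ (fun z => 2 * (y i 0 + rho z))).
    by apply: filterS (nearX x Xx) => z Xz; rewrite phiE // !mxE ei mulr1.
  have := is_derive_mul (is_derive_cst (2 : K) x (1 : K))
      (is_deriveD (is_derive_cst (y i 0) x (1 : K)) (drho x Xx)).
  by rewrite mul0r addr0 add0r.
have dE := is_deriveD (is_deriveB dQ' dQ'')
  (is_derive_mul dphi (is_deriveB dF' dF'')).
apply: (is_derive_eq dE).
rewrite [X in 2 * rho' x * X](_ : _ = F t' x - F t'' x) // /F.
move: (upper_metric t' _ i j) (upper_metric t'' _ i j) (phi _ i 0) (A _)^-1.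
by move=> s' s'' s r; ring.
Qed.

End Uniqueness.

(** * Real parts along the segment from 0 to 1 *)

Section RealPaths.
Context {R : realType}.
Local Notation C := (CC R).
Local Notation toC := (real_complex R : R -> C).
Local Notation re := (@complex.Re R : C -> R).

Lemma norm_toC (x : R) : `|toC x| = toC `|x|.
Proof. by rewrite normc_def /= expr0n /= addr0 sqrtr_sqr. Qed.

(** Real increments are particular complex ones, and taking real parts does not increase the
    modulus. *)
Lemma is_derive_Re (E : C -> C) (t : R) (l : C) :
  is_derive (toC t) (1 : C) E l -> is_derive t (1 : R) (re \o E \o toC) (re l).
Proof.
move=> [/cvg_ex[l' El'] <-].
have -> : 'D_1 E (toC t) = l' by apply: cvg_lim => //; exact: El'.
have cvgRe : (fun h : R => h^-1 *: ((re \o E \o toC) (h *: 1 + t) -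
    (re \o E \o toC) t)) @ 0^' --> re l'.
  apply/cvgrPdist_lt => e e0.
  have e0' : 0 < toC e by rewrite ltcR.
  have [d /= d0 dE] := (cvgrPdist_lt _ _).1 El' _ e0'.
  (* A positive element of [C] is real, so the radius [d] comes from a real one. *)
  have dR : toC (re d) = d by apply: RRe_real; exact: gtr0_real.
  exists (re d); first by rewrite /= -ltcR dR.
  move=> h /= hd h0.
  have hd' : ball_ Num.norm 0 d (toC h).
    by rewrite /ball_ /= sub0r normrN norm_toC -dR ltcR -normrN -sub0r.
  have h0' : toC h != 0 by apply: contraNneq h0 => -[->].
  have := dE (toC h) hd' h0'.
  have -> : (toC h)^-1 *: ((E \o shift (toC t)) (toC h *: 1) - E (toC t)) =
      toC h^-1 * (E (toC (h *: 1 + t)) - E (toC t)).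
    by rewrite fmorphV /= [toC h *: _]mulr1 [h *: _]mulr1 rmorphD.
  set z := E _ - _; set w := l' - _ => lt_w; rewrite -ltcR.
  apply: le_lt_trans lt_w; apply: le_trans (normc_ge_Re w).
  rewrite lecR /w /z; case: (E _) => x1 y1; case: (E _) => x2 y2; case: (l') => x3 y3.
  by rewrite /= mul0r subr0.
by split; [apply/cvg_ex; exists (re l')|apply: cvg_lim => //; exact: cvgRe].
Qed.

(** By the mean value theorem the real part of [E] increases strictly on each half of the interval.
    The midpoint is exempt because the path used below is stationary there. *)
Lemma closed_real_path (E dE : C -> C) :
  (forall t : R, 0 <= t <= 1 -> is_derive (toC t) (1 : C) E (dE (toC t))) ->
  (forall t : R, 0 < t < 1 -> t != 2^-1 -> 0 < re (dE (toC t))) ->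
  E 0 <> E 1.
Proof.
move=> dE1 dE0 E01; pose f := re \o E \o toC.
have df (t : R) : 0 <= t <= 1 -> is_derive t (1 : R) f (re (dE (toC t))).
  by move=> /dE1; exact: is_derive_Re.
have half : 0 < (2^-1 : R) < 1 by apply/andP; split; lra.
have step (p q : R) : 0 <= p -> p < q -> q <= 1 ->
    (forall t, p < t < q -> t != 2^-1) -> f p < f q.
  move=> p0 pq q1 nhalf.
  have inI t : t \in `[p, q]%R -> 0 <= t <= 1.
    by rewrite in_itv /= => /andP[pt tq]; rewrite (le_trans p0 pt) (le_trans tq q1).
  have [||t tI fE] := @MVT R f (re \o dE \o toC) p q pq.
  - by move=> t tI; apply/df/inI; exact: subset_itv_oo_cc.
  - apply: derivable_within_continuous => t tI.
    by have [] := df t (inI t tI).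
  - rewrite -subr_gt0 fE mulr_gt0 ?subr_gt0 //.
    move: tI; rewrite in_itv /= => /andP[pt tq].
    apply: dE0; last by apply: nhalf; rewrite pt.
    by rewrite (le_lt_trans p0 pt) (lt_le_trans tq q1).
have f1 : f 0 < f 2^-1.
  by apply: step => //; [lra|lra|move=> t /andP[_ ?]; rewrite lt_eqF].
have f2 : f 2^-1 < f 1.
  by apply: step => //; [lra|lra|move=> t /andP[? _]; rewrite gt_eqF].
by have := lt_trans f1 f2; rewrite /f /= rmorph0 rmorph1 E01 ltxx.
Qed.

End RealPaths.

(** * Curves with a polynomial parameter, and polynomials flat at 0 and 1 *)

Section PolynomialCurves.
Context {K : numFieldType} {V : normedModType K}.
Implicit Types (p : {poly K}) (v w : V).

Lemma is_derive_horner p (x : K) : is_derive x (1 : K) (horner p) (deriv p).[x].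
Proof.
elim/poly_ind: p => [|p c ih].
  rewrite (_ : horner 0 = cst 0); last by apply/funext => y; rewrite horner0.
  by rewrite deriv0 horner0; exact: is_derive_cst.
rewrite (_ : horner _ = (fun y => p.[y] * y) + cst c); last first.
  by apply/funext => y /=; rewrite !hornerE.
have := is_deriveD (is_derive_mul ih (is_derive_id x (1 : K)))
  (is_derive_cst c x (1 : K)).
move=> dd; apply: (is_derive_eq dd).
by rewrite derivMXaddC !hornerE; ring.
Qed.

Lemma is_derive_curve w p v (x : K) :
  is_derive x (1 : K) (fun y => w + p.[y] *: v) ((deriv p).[x] *: v).
Proof.
have := is_deriveD (is_derive_cst w x (1 : K))
  (is_derive_scalel v (is_derive_horner p x)).
by rewrite add0r.
Qed.

Lemma holomorphic_curve (X : set K) w p v :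
  holomorphic X (fun x => w + p.[x] *: v).
Proof.
move=> k; elim: k w p => [|k ih] w p.
  split=> // x _; apply/derivable1_diffP.
  by have [] := is_derive_curve w p v x.
split=> [x _|r].
  by apply/derivable1_diffP; have [] := is_derive_curve w p v x.
(* Derivatives are again curves of this form, now based at 0, as the induction demands. *)
have -> : 'D_r (fun x => w + p.[x] *: v) = (fun x => 0 + (r *: deriv p).[x] *: v).
  apply/funext => x.
  have [dc cE] := is_derive_curve w p v x.
  have dd : differentiable (fun x => w + p.[x] *: v) x by apply/derivable1_diffP.
  rewrite deriveE // -[r]mulr1 -[r * 1]/(r *: 1) linearZ /= -deriveE // cE.
  by rewrite scalerA add0r hornerZ [r *: 1]mulr1.
exact: ih.
Qed.

Lemma derive1n_curve w p v k x : (0 < k)%N ->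
  derive1n k (fun y => w + p.[y] *: v) x = (derivn k p).[x] *: v.
Proof.
case: k => // k _; elim: k x => [|k ih] x.
  by rewrite derive1n1 derive1E (@derive_val _ _ _ _ _ _ _ (is_derive_curve w p v x)).
rewrite derive1nS derive1E.
have -> : derive1n k.+1 (fun y => w + p.[y] *: v) =
    fun y => 0 + (derivn k.+1 p).[y] *: v.
  by apply/funext => y; rewrite ih add0r.
rewrite (@derive_val _ _ _ _ _ _ _ (is_derive_curve 0 (derivn k.+1 p) v x)).
by rewrite -derivnS.
Qed.

End PolynomialCurves.

(** Each derivation removes one factor ['X - x%:P] and alters the cofactor [q], which the induction
    therefore generalises. *)
Lemma derivn_root {F : fieldType} (p q : {poly F}) (x : F) k M :
  (k < M)%N -> p = q * ('X - x%:P) ^+ M -> (derivn k p).[x] = 0.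
Proof.
elim: k M p q => [|k ih] [|M] p q // kM ->.
  by rewrite derivn0 !hornerE subrr expr0n mulr0.
rewrite derivSn; apply: (ih M _ (deriv q * ('X - x%:P) + q *+ M.+1)) => //.
by rewrite derivM deriv_exp derivXsubC exprS; ring.
Qed.

(** The derivatives up to order [m.+1] vanish at 0 and 1: this covers the jets of order [m] and,
    even for [m = 0], the first derivative. *)
Definition bump_poly {F : fieldType} (r : F) (m : nat) : {poly F} :=
  r *: ('X * (1 - 'X)) ^+ m.+2.

Lemma bump_derivn {F : fieldType} (r : F) m k : (k <= m.+1)%N ->
  (derivn k (bump_poly r m)).[0] = 0 /\ (derivn k (bump_poly r m)).[1] = 0.
Proof.
move=> km; split.
  apply: (@derivn_root _ _ (r *: (1 - 'X) ^+ m.+2) _ _ m.+2) => //.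
  by rewrite subr0 /bump_poly exprMn -scalerAl mulrC.
apply: (@derivn_root _ _ ((-1) ^+ m.+2 * r *: 'X ^+ m.+2) _ _ m.+2) => //.
have -> : bump_poly r m = r *: ('X * ((-1) *: ('X - 1%:P))) ^+ m.+2.
  by rewrite scaleN1r opprB.
by rewrite exprMn exprZn -scalerAr -!scalerAl scalerA mulrC.
Qed.

(** Over the reals with [r] nonzero, this factorization shows that 1/2 is the only zero strictly
    between 0 and 1. *)
Lemma bump_deriv {F : fieldType} (r : F) m (x : F) :
  (deriv (bump_poly r m)).[x] = r * (x * (1 - x)) ^+ m.+1 * (1 - 2 * x) *+ m.+2.
Proof.
rewrite /bump_poly derivZ deriv_exp derivM derivB derivX derivC.
rewrite hornerZ hornerMn succnK !hornerE mulrnAr; congr (_ *+ _); ring.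
Qed.

Lemma map_bump {F F' : fieldType} (f : {rmorphism F -> F'}) r m :
  map_poly f (bump_poly r m) = bump_poly (f r) m.
Proof.
by rewrite /bump_poly map_polyZ rmorphXn rmorphM rmorphB /= map_polyX rmorph1.
Qed.

(** * Lines and preimages under projective maps *)

Section ProjectiveLines.
Context {K : numFieldType} {n : nat}.
Local Notation V := 'cV[K]_n.
Variable a : 'M[K]_(n + 1).
Local Notation A := (reciprocal_factor a).
Local Notation phi := (projective_map a).

Lemma homog_image u k s (y e : V) : k != 0 ->
  a *m homog u = k *: homog y + s *: col_mx e 0 ->
  A u = k /\ phi u = y + (s / k) *: e.
Proof.
move=> k0; rewrite /homog -[a in LHS]submxK mul_block_col !mulmx1.
rewrite !scale_col_mx add_col_mx scaler0 addr0 => /eq_col_mx[top bot].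
have Ak : A u = k.
  rewrite reciprocal_factorE; have := congr1 (fun M : 'M_1 => M 0 0) bot.
  by rewrite !mxE eqxx mulr1.
split=> //; rewrite projective_mapE Ak top scalerDr !scalerA mulVf // scale1r.
by rewrite mulrC.
Qed.

Hypothesis ua : a \in unitmx.

(** Otherwise the last row of [a] would vanish. *)
Lemma exists_factor_neq0 : exists u, A u != 0.
Proof.
apply/not_existsP => A0.
have {}A0 u : A u = 0 by apply/eqP/negPn/negP/A0.
have d0 : drsubmx a 0 0 = 0.
  by have := A0 0; rewrite reciprocal_factorE mulmx0 mxE add0r.
have c0 j : dlsubmx a 0 j = 0.
  have := A0 (delta_mx j 0).
  by rewrite reciprocal_factorE d0 addr0 -colE mxE.
have : delta_mx 0 (rshift n 0) *m a = 0 :> 'rV_(n + 1).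
  rewrite -rowE; apply/matrixP => i j; rewrite ord1 !mxE.
  case: (split_ordP j) => k ->; first by have := c0 k; rewrite !mxE.
  by have := d0; rewrite !mxE [k]ord1.
move=> /(congr1 (fun M => (M *m invmx a) 0 (rshift n 0))).
by rewrite mulmxK // mul0mx !mxE !eqxx => /eqP; rewrite oner_eq0.
Qed.

Lemma projective_map_surj y : reciprocal_factor (invmx a) y != 0 ->
  exists u, A u != 0 /\ phi u = y.
Proof.
move=> A'0; exists (projective_map (invmx a) y).
have := mul_homog A'0; set u := projective_map _ _; set k := reciprocal_factor _ _.
move=> /(congr1 (fun X => k^-1 *: (a *m X))).
rewrite mulKVmx // -scalemxAr scalerA mulVf // scale1r => E.
have [||-> ->] := @homog_image u k^-1 0 y 0; rewrite ?invr_eq0 //.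
  by rewrite -E scale0r addr0.
by rewrite scaler0 addr0.
Qed.

(** [W] is the preimage of the direction [(e, 0)] and [kappa] its last coordinate. The choice of [v]
    makes [homog (u0 + s *: v)] equal to [(1 - s * kappa) *: homog u0 + s *: W], which [a] sends
    over the line through [phi u0] along [e]. *)
Lemma projective_line u0 (e : V) : A u0 != 0 -> exists (v : V) (kappa : K),
  forall s, let k := A u0 * (1 - s * kappa) in
  A (u0 + s *: v) = k /\
  (k != 0 -> phi (u0 + s *: v) = phi u0 + (s / k) *: e).
Proof.
move=> A0; pose W := invmx a *m (col_mx e 0 : 'cV_(n + 1)).
pose kappa := dsubmx W 0 0; exists (usubmx W - kappa *: u0), kappa => s k.
have aE : a *m homog (u0 + s *: (usubmx W - kappa *: u0)) =
    k *: homog (phi u0) + s *: col_mx e 0.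
  have -> : homog (u0 + s *: (usubmx W - kappa *: u0)) =
      (1 - s * kappa) *: homog u0 + s *: W.
    rewrite -[W in RHS]vsubmxK /homog !scale_col_mx add_col_mx; congr col_mx.
      by rewrite scalerBr scalerBl scale1r scalerA -addrA; congr (_ + _); rewrite addrC.
    apply/matrixP => i j; rewrite !ord1 [RHS]mxE [X in _ = X + _]mxE [X in _ = _ + X]mxE.
    by rewrite mxE eqxx mulr1 /kappa subrK.
  rewrite mulmxDr -!scalemxAr mul_homog // scalerA mulrC -/k; congr (_ + _ *: _).
  by rewrite mulKVmx.
split; last by move=> k0; have [] := homog_image k0 aE.
move: aE; rewrite /homog -[a in LHS]submxK mul_block_col !mulmx1.
rewrite !scale_col_mx add_col_mx scaler0 addr0 => /eq_col_mx[_ bot].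
rewrite reciprocal_factorE; have := congr1 (fun M : 'M_1 => M 0 0) bot.
by rewrite mxE [X in _ = X]mxE [1%:M _ _]mxE eqxx mulr1.
Qed.

End ProjectiveLines.

(** * Generic points at which two metrics differ *)

Section Generic.
Context {K : numFieldType} {n : nat}.
Local Notation V := 'cV[K]_n.

Lemma line_polynomial_affine (P : V -> K) :
  (forall u v s, P (u + s *: v) = P u + s * (P v - P 0)) -> line_polynomial P.
Proof.
move=> aff u v; exists ((P u)%:P + 'X * (P v - P 0)%:P) => s.
by rewrite aff !hornerE.
Qed.

(** Two determinants, the factor and one entry of the difference of the lower metrics are polynomial
    along lines, hence nonzero at a common point. Distinct lower metrics have distinct images under
    [invmx]. *)
Lemma generic_point (a : 'M[K]_(n + 1)) (t t' : @tensors K n) :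
  a \in unitmx -> t <> t' ->
  (exists y, lower_metric t y \in unitmx) ->
  (exists y, lower_metric t' y \in unitmx) ->
  exists y, [/\ lower_metric t y \in unitmx, lower_metric t' y \in unitmx,
    reciprocal_factor a y != 0 & upper_metric t y != upper_metric t' y].
Proof.
move=> ua tt' [y1 y1u] [y2 y2u].
have line_det (s : @tensors K n) : line_polynomial (fun y => \det (lower_metric s y)).
  by apply: line_polynomial_det => y z c; exact: lower_metric_line.
have line_A : line_polynomial (reciprocal_factor a).
  apply: line_polynomial_affine => y z c; rewrite !reciprocal_factorE.
  by rewrite mulmxDr -scalemxAr mulmx0 !mxE; ring.
have [y3 [i [j D]]] : exists y i j, lower_metric t y i j - lower_metric t' y i j != 0.
  apply/not_existsP => D; apply: tt'; apply: lower_metric_inj.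
  apply/funext => y; apply/matrixP => i j; apply/eqP; rewrite -subr_eq0.
  by apply/negPn/negP => Dij; apply: (D y); exists i, j.
have line_D : line_polynomial (fun y => lower_metric t y i j - lower_metric t' y i j).
  apply: line_polynomial_affine => y z c; rewrite !lower_metric_line.
  move: (lower_metric t y) (lower_metric t z) (lower_metric t 0).
  move: (lower_metric t' y) (lower_metric t' z) (lower_metric t' 0) => *.
  by rewrite !mxE; ring.
have [] := line_polynomial_neq0 (line_polynomialM (line_det t) (line_det t'))
  (line_polynomialM line_A line_D).
- apply: (line_polynomial_neq0 (line_det t) (line_det t')).
    by exists y1; move: y1u; rewrite unitmxE unitfE.
  by exists y2; move: y2u; rewrite unitmxE unitfE.
- apply: (line_polynomial_neq0 line_A line_D); last by exists y3.
  exact: exists_factor_neq0.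
move=> y; rewrite !mulf_eq0 !negb_or => /andP[/andP[dt dt'] /andP[Ay Dy]].
exists y; rewrite !unitmxE !unitfE; split=> //.
apply: contraNneq Dy => /(congr1 invmx); rewrite /upper_metric !invmxK => ->.
by rewrite subrr.
Qed.

End Generic.

(** * A path that separates two candidate transforms *)

Section SeparatingPath.
Context {K : numFieldType} {n : nat}.
Local Notation V := 'cV[K]_n.
Variables (a : 'M[K]_(n + 1)) (t t' t'' : @tensors K n).
Local Notation A := (reciprocal_factor a).
Local Notation phi := (projective_map a).

(** The field is [u0 + p v] with [p] the bump, and [E] is the function of [null_pair], normalised so
    that [Phi] is 1 where [p] vanishes. Both [d] and [m] precede [r], so that the amplitude can be
    made small afterwards. *)
Lemma separating_path : a \in unitmx ->
  (forall u, A u != 0 -> lower_metric t'' (phi u) \in unitmx ->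
    lower_metric t u \in unitmx) ->
  (exists y, lower_metric t' y \in unitmx) ->
  (exists y, lower_metric t'' y \in unitmx) ->
  reciprocal_transform a (upper_metric t) (upper_metric t') ->
  reciprocal_transform a (upper_metric t) (upper_metric t'') ->
  t' <> t'' -> exists (d : K) (m : nat), 0 < d /\ forall r : K,
    exists E Phi : K -> K,
    [/\ E 0 = E 1, forall x, `|(bump_poly r m).[x]| < d -> `|1 - Phi x| < 1 &
      forall x, `|(bump_poly r m).[x]| < d ->
        is_derive x (1 : K) E ((deriv (bump_poly r m)).[x] ^+ 2 * Phi x)].
Proof.
move=> ua regt reg' reg'' tr' tr'' ne.
have ua' : invmx a \in unitmx by rewrite unitmx_inv.
(* The point [y] lives in the target; a nonzero factor of [invmx a] makes it the image of some
   [u0]. *)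
have [y [y' y'' Ay upper_ne]] := generic_point ua' ne reg' reg''.
have [i [j Dij]] : exists i j, upper_metric t' y i j - upper_metric t'' y i j != 0.
  apply/not_existsP => D; move/eqP: upper_ne; apply; apply/matrixP => i j.
  by apply/eqP; rewrite -subr_eq0; apply/negPn/negP => Dij; apply: (D i); exists j.
have [u0 [A0 phi0]] := projective_map_surj ua Ay.
have Gu0 : lower_metric t u0 \in unitmx by apply: (regt u0 A0); rewrite phi0.
(* All coordinates are 1, which suits [null_pair] for whichever [i] and [j] were found. *)
pose e : V := const_mx 1.
have [v [kappa line]] := projective_line ua e A0.
pose k (s : K) := A u0 * (1 - s * kappa).
pose Y s := y + (s / k s) *: e.
pose D s := upper_metric t' (Y s) i j - upper_metric t'' (Y s) i j.
(* This is the derivative of [s / k s], because [k s - s k'] equals [A u0]. *)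
pose q s := A u0 / (k s * k s).
pose Theta s := q s * q s / k s * D s.
have k0 : k 0 = A u0 by rewrite /k mul0r subr0 mulr1.
have Y0 : Y 0 = y by rewrite /Y mul0r scale0r addr0.
have q0 : q 0 != 0 by rewrite /q k0 mulf_neq0 // invr_eq0 mulf_neq0.
have Theta0 : Theta 0 != 0.
  rewrite /Theta /D Y0; apply: mulf_neq0 => //; apply: mulf_neq0.
    exact: mulf_neq0.
  by rewrite invr_eq0 k0.
have dk s : is_derive s (1 : K) k (- (A u0 * kappa)).
  have := is_derive_mul (is_derive_cst (A u0) s (1 : K))
    (is_deriveB (is_derive_cst (1 : K) s (1 : K))
      (is_derive_mul (is_derive_id s (1 : K)) (is_derive_cst kappa s (1 : K)))).
  move=> dd; apply: (is_derive_eq dd).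
  by rewrite mul0r addr0 mulr0 !add0r mul1r mulrN.
have dkd s : differentiable k s by apply/derivable1_diffP; have [] := dk s.
have did : differentiable (fun s : K => s) 0 by exact: ex_diff.
have dkV : differentiable (fun s => (k s)^-1) 0.
  by apply: differentiable_inv; [rewrite k0|exact: dkd].
have dY : differentiable Y 0.
  apply: differentiableD; first exact: differentiable_cst.
  apply: differentiable_scalemx; last exact: differentiable_cst.
  exact: (differentiable_mul did dkV).
have dup (s : @tensors K n) : lower_metric s y \in unitmx ->
    differentiable (fun r => upper_metric s (Y r)) 0.
  move=> us; apply: (differentiable_comp dY).
  by apply: differentiable_upper_metric; rewrite Y0 upper_metric_unit.
have dlow (s : @tensors K n) : differentiable (fun r => lower_metric s (Y r)) 0.
  by apply: (differentiable_comp dY); exact: differentiable_lower_metric.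
have dq : differentiable q 0.
  apply: differentiable_mul; first exact: differentiable_cst.
  apply: differentiable_inv; first by rewrite k0 mulf_neq0.
  exact: (differentiable_mul (dkd 0) (dkd 0)).
have dD : differentiable D 0.
  by apply: differentiableB; apply: differentiable_entry; exact: dup.
have dTheta : differentiable (fun s => Theta s / Theta 0) 0.
  apply: differentiable_mul; last exact: differentiable_cst.
  exact: (differentiable_mul (differentiable_mul (differentiable_mul dq dq) dkV) dD).
have du0 : differentiable (fun s : K => u0 + s *: v) 0.
  apply: differentiableD; first exact: differentiable_cst.
  exact: (differentiable_scalemx did (differentiable_cst _ _)).
have near_k : \forall s \near (0 : K), k s != 0.
  have /differentiable_continuous ck := dkd 0.
  by apply: (cvgr_neq0 _ ck); rewrite k0.
have near_t : \forall s \near (0 : K), lower_metric t (u0 + s *: v) \in unitmx.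
  have dt : differentiable (fun s : K => lower_metric t (u0 + s *: v)) 0.
    exact: (differentiable_comp du0 (differentiable_lower_metric t _)).
  have t0u : lower_metric t (u0 + 0 *: v) \in unitmx by rewrite scale0r addr0.
  exact: (near_unitmx dt t0u).
have near_Y s : lower_metric s y \in unitmx ->
    \forall z \near (0 : K), lower_metric s (Y z) \in unitmx.
  by rewrite -{1}Y0 => sYu; exact: (near_unitmx (dlow s) sYu).
have near_Theta : \forall s \near (0 : K), `|1 - Theta s / Theta 0| < 1.
  by have := near_dist_lt dTheta (ltr01 : 0 < (1 : K)); rewrite divff.
have good : \forall s \near (0 : K), [/\ k s != 0,
    lower_metric t (u0 + s *: v) \in unitmx,
    lower_metric t' (Y s) \in unitmx, lower_metric t'' (Y s) \in unitmx &
    `|1 - Theta s / Theta 0| < 1].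
  have near_t' := near_Y t' y'; have near_t'' := near_Y t'' y''.
  by near=> s; split; near: s.
have [d /= d0 {}good] := good.
have {}good s : `|s| < d -> [/\ k s != 0,
    lower_metric t (u0 + s *: v) \in unitmx,
    lower_metric t' (Y s) \in unitmx, lower_metric t'' (Y s) \in unitmx &
    `|1 - Theta s / Theta 0| < 1].
  by move=> sd; apply: good; rewrite /= sub0r normrN.
have [m pair] := null_pair i j tr' tr''.
exists d, m; split; first exact: d0.
move=> r; set p := bump_poly r m.
pose X : set K := [set x | `|p.[x]| < d].
have oX : open X.
  rewrite (_ : X = horner p @^-1` ball (0 : K) d); last first.
    by apply/seteqP; split=> x; rewrite /X /= -ball_normE /= sub0r normrN.
  apply: open_comp; last exact: ball_open.
  move=> x _; apply: differentiable_continuous.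
  by apply/derivable1_diffP; have [] := is_derive_horner p x.
pose u x := u0 + p.[x] *: v.
pose rho x := p.[x] / k p.[x].
pose rho' x := (deriv p).[x] * q p.[x].
have phiE x : X x -> phi (u x) = y + rho x *: e.
  by move=> /good[kx _ _ _ _]; have [_ /(_ kx)] := line p.[x]; rewrite phi0.
have AE x : A (u x) = k p.[x] by have [] := line p.[x].
have dp x := is_derive_horner p x.
have dkp x : is_derive x (1 : K) (fun x => k p.[x])
    (- (A u0 * kappa * (deriv p).[x])).
  have := is_derive_mul (is_derive_cst (A u0) x (1 : K))
    (is_deriveB (is_derive_cst (1 : K) x (1 : K))
      (is_derive_mul (dp x) (is_derive_cst kappa x (1 : K)))).
  move=> dd; apply: (is_derive_eq dd).
  by rewrite mul0r addr0 mulr0 !add0r mulrN [(deriv p).[x] * _]mulrC mulrA.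
have drho x : X x -> is_derive x (1 : K) rho (rho' x).
  move=> /good[kx _ _ _ _].
  have := is_derive_mul (dp x) (is_derive_inv (f := fun x => k p.[x]) kx (dkp x)).
  move=> dd; apply: (is_derive_eq dd); rewrite /rho' /q.
  move: kx; rewrite /k; move: (A u0) p.[x] (deriv p).[x] => b z z' kx.
  by field; move: kx; rewrite mulf_eq0 negb_or => /andP[-> ->].
have drho' x : X x -> differentiable rho' x.
  move=> /good[kx _ _ _ _]; have dkpd : differentiable (fun x => k p.[x]) x.
    by apply/derivable1_diffP; have [] := dkp x.
  apply: differentiable_mul.
    by apply/derivable1_diffP; have [] := is_derive_horner (deriv p) x.
  apply: differentiable_mul; first exact: differentiable_cst.
  apply: differentiable_inv; first by rewrite mulf_neq0.
  exact: (differentiable_mul dkpd dkpd).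
have uX x : X x -> [/\ A (u x) != 0, upper_metric t (u x) \in unitmx,
    upper_metric t' (phi (u x)) \in unitmx &
    upper_metric t'' (phi (u x)) \in unitmx].
  move=> Xx; have [kx ? ? ? _] := good _ Xx.
  by rewrite !upper_metric_unit AE phiE.
have e1 l : e l 0 = 1 by rewrite mxE.
have [E [dE Eq]] := pair X u rho rho' y e oX (holomorphic_curve X u0 p v)
  uX phiE drho drho' (e1 i) (e1 j).
(* The derivative of [E] is [4 p'^2 Theta(p)], hence the normalising constant. *)
exists (fun x => E x * (4 * Theta 0)^-1), (fun x => Theta p.[x] / Theta 0).
split.
- congr (_ * _); apply: Eq.
  (* Column 0 of the jet sees the bump itself, the others its derivatives; all of these vanish at 0
     and 1. *)
  + apply/matrixP => l o; rewrite !mxE; case: o => [[|o] lo].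
      have [z0 z1] := bump_derivn r (leq0n m.+1).
      by move: z0 z1; rewrite !derive1n0 !derivn0 /u /p => -> ->.
    have [z0 z1] := bump_derivn r (ltnW lo).
    by rewrite /u !derive1n_curve // /p z0 z1.
  + have [d0' _] := bump_derivn r (isT : (1 <= m.+1)%N).
    by rewrite /rho' [X in X * _]d0' mul0r.
  + have [_ d1'] := bump_derivn r (isT : (1 <= m.+1)%N).
    by rewrite /rho' [X in X * _]d1' mul0r.
- by move=> x /good[].
- move=> x Xx.
  have := is_derive_mul (dE x Xx) (is_derive_cst (4 * Theta 0)^-1 x (1 : K)).
  move=> dd; apply: (is_derive_eq dd).
  have ThetaE : Theta p.[x] = q p.[x] * q p.[x] / k p.[x] * D p.[x] by [].
  rewrite mulr0 add0r AE phiE // -/(Y p.[x]) -/(D p.[x]) /rho' ThetaE /=.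
  have [kx _ _ _ _] := good _ Xx; move: Theta0 kx.
  move: (Theta 0) (k _) (q _) (D _) (deriv p).[x] => T0 k1 q1 D1 p1 T00 k10.
  by rewrite /cst; field; rewrite T00 k10.
Unshelve. all: by end_near. Qed.

End SeparatingPath.

(** * Uniqueness of the transform over the complex numbers, and the conclusion *)

Section Uniqueness.
Context {R : realType} {n : nat}.
Local Notation C := (CC R).
Local Notation toC := (real_complex R : R -> C).
Local Notation re := (@complex.Re R : C -> R).

Lemma re_gt0 (z : C) : `|1 - z| < 1 -> 0 < re z.
Proof.
move=> /(le_lt_trans (normc_ge_Re _)); rewrite -(rmorph1 (real_complex R)) ltcR.
by rewrite ltr_norml => /andP[_]; case: z => x y /=; lra.
Qed.

Lemma bump_itv (r s : R) m : 0 <= r -> 0 <= s <= 1 -> `|(bump_poly r m).[s]| <= r.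
Proof.
move=> r0 /andP[s0 s1].
have -> : (bump_poly r m).[s] = r * (s * (1 - s)) ^+ m.+2.
  by rewrite hornerZ horner_exp !hornerE.
have h0 : 0 <= s * (1 - s) by rewrite mulr_ge0 // subr_ge0.
rewrite ger0_norm; last by apply: mulr_ge0 => //; exact: exprn_ge0.
rewrite -[leRHS]mulr1 ler_wpM2l // exprn_ile1 //.
by rewrite (le_trans _ s1) // ler_piMr // lerBlDr lerDl.
Qed.

(** For distinct tensors, [separating_path] gives [E 0 = E 1]. At a small real amplitude the
    derivative of [E] has positive real part on the open unit interval away from 1/2, which
    [closed_real_path] excludes. *)
Lemma reciprocal_transform_unique (a : 'M[C]_(n + 1)) (t t' t'' : @tensors C n) :
  a \in unitmx ->
  (forall u, reciprocal_factor a u != 0 ->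
    lower_metric t'' (projective_map a u) \in unitmx ->
    lower_metric t u \in unitmx) ->
  (exists y, lower_metric t' y \in unitmx) ->
  (exists y, lower_metric t'' y \in unitmx) ->
  reciprocal_transform a (upper_metric t) (upper_metric t') ->
  reciprocal_transform a (upper_metric t) (upper_metric t'') ->
  t' = t''.
Proof.
move=> ua regt reg' reg'' tr' tr''; apply: contrapT => ne.
have [d [m [d0 path]]] := separating_path ua regt reg' reg'' tr' tr'' ne.
have dR : toC (re d) = d by apply: RRe_real; exact: gtr0_real.
have red0 : 0 < re d by rewrite -ltcR dR.
(* On the unit interval the bump is bounded by its amplitude; half of [re d] keeps it strictly below
   [d]. *)
have [E [Phi [E01 Phi1 dE]]] := path (toC (re d / 2)).
set p := bump_poly _ m in Phi1 dE; pose pR := bump_poly (re d / 2) m.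
have pE : p = map_poly (real_complex R) pR by rewrite map_bump.
have small (s : R) : 0 <= s <= 1 -> `|p.[toC s]| < d.
  move=> s01; rewrite pE horner_map norm_toC -dR ltcR.
  have r0 : 0 <= re d / 2 by rewrite divr_ge0 // ltW.
  apply: le_lt_trans (bump_itv m r0 s01) _.
  by rewrite ltr_pdivrMr // ltr_pMr // ltr1n.
apply: (@closed_real_path R E (fun x => (deriv p).[x] ^+ 2 * Phi x)) => //.
  by move=> s s01; apply: dE; exact: small.
move=> s /andP[s0 s1] s2.
have s01 : 0 <= s <= 1 by rewrite (ltW s0) (ltW s1).
have := re_gt0 (Phi1 _ (small s s01)).
(* [p] has real coefficients, so at real points [p'^2] is a real square and factors out of the real
   part. *)
rewrite pE deriv_map horner_map -rmorphXn /=; case: (Phi _) => x y /= x0.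
rewrite mul0r subr0 mulr_gt0 // exprn_even_gt0 //= bump_deriv.
rewrite mulrn_eq0 /= mulf_neq0 //; last first.
  by apply: contraNneq s2 => s2; apply/eqP; lra.
apply: mulf_neq0; first by rewrite gt_eqF // divr_gt0.
by rewrite expf_neq0 // mulf_neq0 // gt_eqF // subr_gt0.
Qed.

End Uniqueness.

Theorem theorem2 (R : realType) (n : nat) :
  [/\ set_bij (@three_forms (CC R) n) skew_tensors tensors_of_form,
      set_bij (@nondegenerate_three_forms (CC R) n) hamiltonian_operators
        operator_of_form
    & forall a : 'M[CC R]_(n + 1), \det a = 1 ->
      forall om, nondegenerate_three_forms om ->
        nondegenerate_three_forms (form_action a om) /\
        forall g', hamiltonian_operators g' /\
            reciprocal_transform a (operator_of_form om) g' <->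
          g' = operator_of_form (form_action a om)].
Proof.
split; [exact: forms_tensors_bij|exact: forms_operators_bij|].
move=> a a1 om ndom.
have ua : a \in unitmx by rewrite unitmxE a1 unitr1.
have [om3 regom] := (nondegenerateE om).1 ndom.
have ndom' := nondegenerate_action ua ndom; split=> // g'.
have [om3' regom'] := (nondegenerateE _).1 ndom'.
have tr := reciprocal_transform_form_action ua om3.
split=> [[[t [_ -> [y yu]]] tr']|->]; last first.
  by split=> //; have [hom _ _] := @forms_operators_bij (CC R) n; exact: hom.
rewrite /operator_of_form; congr upper_metric.
(* [g'] is compared with the transform already constructed. Where the metric of the latter is
   regular at the image of [u], the congruence makes that of [om] regular at [u]. *)
apply: (reciprocal_transform_unique ua _ _ regom' tr' tr); last first.
  by exists y; rewrite -upper_metric_unit.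
by move=> u A0; rewrite lower_metric_action_unit.
Qed.
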